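(* Let $\mathcal{S}=(A,B,C,M_1,\ldots,M_p)$ and $\mathcal{S}_r=(A_r,B_r,C_r,M_{1,r},\ldots,M_{p,r})$ be asymptotically stable linear quadratic-output systems of state dimensions $n$ and $r$, respectively, with the same number $m$ of inputs and $p$ of outputs. Then the partial gradients of the squared $\mathcal{H}_2$ error $\mathcal{J}(\mathcal{S}_r)=\|\mathcal{S}-\mathcal{S}_r\|_{\mathcal{H}_2}^2$ with respect to $A_r$, $B_r$, $C_r$ and $M_{k,r}$ are given explicitly by $$\nabla_{A_r}\mathcal{J}=2\left((2Q_r-Q_{1,r})P_r+(2Z^{\mathsf T}-Z_1^{\mathsf T})X\right),$$ $$\nabla_{B_r}\mathcal{J}=2\left((2Q_r-Q_{1,r})B_r+(2Z^{\mathsf T}-Z_1^{\mathsf T})B\right),$$ $$\nabla_{C_r}\mathcal{J}=2\left(C_rP_r-CX\right),$$ $$\nabla_{M_{k,r}}\mathcal{J}=2\left(P_rM_{k,r}P_r-X^{\mathsf T}M_kX\right),\qquad k=1,\ldots,p,$$ where $X,Z,Z_1\in\mathbb{R}^{n\times r}$ and $P_r,Q_r,Q_{1,r}\in\mathbb{R}^{r\times r}$ are the unique solutions of $$A_rP_r+P_rA_r^{\mathsf T}+B_rB_r^{\mathsf T}=0,$$ $$A_r^{\mathsf T}Q_r+Q_rA_r+\sum_{k=1}^pM_{k,r}P_rM_{k,r}+C_r^{\mathsf T}C_r=0,$$ $$AX+XA_r^{\mathsf T}+BB_r^{\mathsf T}=0,$$ $$A^{\mathsf T}Z+ZA_r-\sum_{k=1}^pM_kXM_{k,r}-C^{\mathsf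 T}C_r=0,$$ $$A_r^{\mathsf T}Q_{1,r}+Q_{1,r}A_r+C_r^{\mathsf T}C_r=0,$$ $$A^{\mathsf T}Z_1+Z_1A_r-C^{\mathsf T}C_r=0.$$
   Context: A linear quadratic-output (LQO) system $\mathcal{S}=(A,B,C,M_1,\ldots,M_p)$ of state dimension $n$ with $m$ inputs and $p$ outputs is given by $A,M_1,\ldots,M_p\in\mathbb{R}^{n\times n}$, $B\in\mathbb{R}^{n\times m}$, $C\in\mathbb{R}^{p\times n}$ via $$\dot x(t)=Ax(t)+Bu(t),\quad x(0)=0,\qquad y(t)=Cx(t)+\begin{bmatrix}x(t)^{\mathsf T}M_1x(t)\\ \vdots\\ x(t)^{\mathsf T}M_px(t)\end{bmatrix}.$$ Throughout, the quadratic-output matrices $M_k$ of every LQO system (full or reduced) are symmetric. The system is asymptotically stable if all eigenvalues of $A$ lie in the open left half of the complex plane. A system $\mathcal{S}_r=(A_r,B_r,C_r,M_{1,r},\ldots,M_{p,r})$ is an LQO system of the same form with state dimension $r$, i.e. $A_r,M_{k,r}\in\mathbb{R}^{r\times r}$, $B_r\in\mathbb{R}^{r\times m}$, $C_r\in\mathbb{R}^{p\times r}$. Volterra kernels: let $M\in\mathbb{R}^{p\times n^2}$ be the matrix whose $k$-th row is $\operatorname{vec}(M_k)^{\mathsf T}$. The kernels of $\mathcal{S}$ are $$h_1(t)=Ce^{At}B\in\mathbb{R}^{p\times m},\qquad h_2(t_1,t_2)=M\left(e^{At_1}B\otimes e^{At_2}B\right)\in\mathbb{R}^{p\times m^2},\qquad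 t,t_1,t_2\ge0,$$ and $h_{1,r},h_{2,r}$ are defined analogously for $\mathcal{S}_r$. The squared $\mathcal{H}_2$ error is $$\|\mathcal{S}-\mathcal{S}_r\|_{\mathcal{H}_2}^2=\int_0^\infty\|h_1(\tau)-h_{1,r}(\tau)\|_F^2\,d\tau+\int_0^\infty\int_0^\infty\|h_2(\tau_1,\tau_2)-h_{2,r}(\tau_1,\tau_2)\|_F^2\,d\tau_1\,d\tau_2,$$ where $\|\cdot\|_F$ is the Frobenius norm. The system $\mathcal{S}$ is fixed, and $\mathcal{J}$ is regarded as a real-valued function of the matrices $(A_r,B_r,C_r,M_{1,r},\ldots,M_{p,r})$ in $\mathbb{R}^{r\times r}\times\mathbb{R}^{r\times m}\times\mathbb{R}^{p\times r}\times\mathbb{R}^{r\times r}\times\cdots\times\mathbb{R}^{r\times r}$, on the open set where $A_r$ has all its eigenvalues in the open left half-plane. Partial gradients are taken with respect to the Frobenius inner product $\langle U,V\rangle_F=\operatorname{tr}(U^{\mathsf T}V)$: for each matrix variable $Y$, $\nabla_Y\mathcal{J}$ is the unique matrix (of the same size as $Y$) such that, with all other variables fixed, $\mathcal{J}(Y+\Delta)=\mathcal{J}(Y)+\langle\nabla_Y\mathcal{J},\Delta\rangle_F+R(\Delta)$ with $R(\Delta)/\|\Delta\|_F\to0$ as $\Delta\to0$. *)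

(* Defs.v *)
From HB Require Import structures.
From mathcomp Require Export all_boot all_order all_algebra.
From mathcomp Require Export all_classical all_reals all_analysis.
From mathcomp Require Export complex mxtens.
Export numFieldNormedType.Exports.

Set Implicit Arguments.
Unset Strict Implicit.
Unset Printing Implicit Defensive.

Import Order.TTheory GRing.Theory Num.Theory.

Local Open Scope classical_set_scope.
Local Open Scope ring_scope.

Section MatrixNotions.
Context {R : realType}.

Definition expmx n (A : 'M[R]_n) : 'M[R]_n :=
  limn (series (fun k : nat => (k`!%:R)^-1 *: A ^+ k)).

Definition dotF m n (U V : 'M[R]_(m, n)) : R := \tr (U^T *m V).

Definition normF m n (U : 'M[R]_(m, n)) : R := Num.sqrt (dotF U U).

(* mxvec reads a matrix row by row; transposing first gives the usual
   column-stacking vec, here as a row vector: vec(M)^T. Both mxvec and *t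
   order pairs of indices lexicographically. *)
Definition vecT n (M : 'M[R]_n) : 'rV[R]_(n * n) := mxvec M^T.

(* The topology on matrices is that of the max norm, which coincides with the
   one induced by normF. *)
Definition is_gradient m n (f : 'M[R]_(m, n) -> R) (Y G : 'M[R]_(m, n)) :=
  unique (fun G' : 'M[R]_(m, n) =>
    (f (Y + D) - f Y - dotF G' D) / normF D @[D --> (0 : 'M[R]_(m, n))^']
      --> (0 : R)) G.

Definition asymp_stable n (A : 'M[R]_n) :=
  forall z : R[i], eigenvalue (map_mx (real_complex R) A) z -> complex.Re z < 0.

End MatrixNotions.

(* The system x' = A x + B u, x(0) = 0, with outputs
   y_k = (C x)_k + x^T M_k x. Symmetry of the M_k is not part of the record,
   since gradients in M_k are taken over all square matrices. *)
Record lqo (R : realType) (n m p : nat) := LQO {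
  lqoA : 'M[R]_n;
  lqoB : 'M[R]_(n, m);
  lqoC : 'M[R]_(p, n);
  lqoM : 'I_p -> 'M[R]_n }.

Section H2.
Context {R : realType} {m p : nat}.

Definition kernel1 n (S : lqo R n m p) (t : R) : 'M[R]_(p, m) :=
  lqoC S *m expmx (t *: lqoA S) *m lqoB S.

Definition kernel2 n (S : lqo R n m p) (t1 t2 : R) : 'M[R]_(p, m * m) :=
  (\matrix_(k < p) vecT (lqoM S k)) *m
  ((expmx (t1 *: lqoA S) *m lqoB S) *t (expmx (t2 *: lqoA S) *m lqoB S)).

Definition H2err2_ereal n r (S : lqo R n m p) (Sr : lqo R r m p) : \bar R :=
  ((\int[lebesgue_measure]_(t in `[0%R, +oo[)
      (normF (kernel1 S t - kernel1 Sr t) ^+ 2)%:E)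
   + (\int[lebesgue_measure]_(t1 in `[0%R, +oo[)
      \int[lebesgue_measure]_(t2 in `[0%R, +oo[)
        (normF (kernel2 S t1 t2 - kernel2 Sr t1 t2) ^+ 2)%:E))%E.

(* Both integrals are finite when S and Sr are asymptotically stable; the
   values of fine elsewhere are irrelevant to gradients at a stable Sr, as
   stability is an open condition. *)
Definition H2err2 n r (S : lqo R n m p) (Sr : lqo R r m p) : R :=
  fine (H2err2_ereal S Sr).

End H2.

(* Main.v *)
From HB Require Import structures.
Require Import Defs.
From mathcomp Require Import ring lra.

Set Implicit Arguments.
Unset Strict Implicit.
Unset Printing Implicit Defensive.

Import Order.TTheory GRing.Theory Num.Theory.

Local Open Scope classical_set_scope.
Local Open Scope ring_scope.

(** Stacking a system [S] and a reduced system [Sr] into one block-diagonal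
error system, with input matrix [col_mx B Br], output matrix
[row_mx C (- Cr)] and quadratic outputs [block_mx (M k) 0 0 (- Mr k)], turns
the differences of the kernels of [S] and [Sr] into the kernels of a single
system.  The error is therefore the squared H2 norm of one system
[(A, B, C, M)], and its gradients are the reduced blocks of the gradients of
that norm.

Closed form.  If [P] solves [A P + P A^T + B B^T = 0], then
[e^(tA) P e^(tA)^T] is a primitive of [- e^(tA) B B^T e^(tA)^T] that vanishes
at infinity.  The integrand of the first kernel and, for a fixed first time,
that of the second one are traces of [W e^(tA) B B^T e^(tA)^T] for a constant
[W], so the fundamental theorem of calculus integrates them to [tr (W P)]; the
outcome of the inner integral has the same shape in the other time and
integrates in the same way.  Hence the squared norm is
[tr (C^T C P) + sum_k tr (M_k^T P M_k P)], called [gramian_cost] below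
([H2norm_gramian], [H2err2_gramian]).

Gradients.  Let the [M_k] be symmetric, put
[W = C^T C + 2 sum_k M_k P M_k], and let [L] solve [A^T L + L A + W = 0].  If
the data move so that [P] becomes [P'] with [A P' + P' A^T + V' = 0], then the
cost changes by [<W, P' - P>] up to a term quadratic in [P' - P], and since
[X |-> A X + X A^T] and [Y |-> A^T Y + Y A] are adjoint to each other,
[<W, P' - P> = <L, V' - B B^T>] ([gramian_cost_perturbation]).  Replacing [A]
by [A + D] gives [V' - B B^T = D P' + P' D^T], and replacing [B] by [B + D]
gives [B D^T + D B^T + D D^T]; so the gradients are [2 L P] and [2 L B], with
no need to differentiate the solution map of the Lyapunov equation: the
remainders are quadratic because its operator has a bounded inverse.  The
gradients in [C] and [M_k], which do not affect [P], are [2 C P] and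
[2 P M_k P].  For the error system, the second block row of [L] is
[2 Z^T - Z1^T] and [2 Qr - Q1r], and [P] has the blocks [X] and [Pr]; reading
off blocks gives the four formulas.

Stability.  All that is used of the spectrum of [A] is that [e^(tA)] tends to
0, but this is needed for every reduced matrix near the given one.  It comes
from a quadratic Lyapunov function ([lyapunov_certified]), whose existence is
an open condition and passes to block-diagonal matrices.  Such a function is
built by triangularizing [A] over the complex numbers and rescaling the basis
until the triangular matrix is almost diagonal
([lyapunov_certified_of_asymp_stable]). *)

(** * Limits, derivatives and norms of matrices, entry by entry *)

Section Entrywise.
Context {R : realType}.

Lemma le_entry_norm m n (M : 'M[R]_(m, n)) i j : `|M i j| <= `|M|.
Proof.
rewrite [leRHS]/Num.Def.normr/= mx_normrE.
exact: (le_bigmax _ (fun ij : 'I_m * 'I_n => `|M ij.1 ij.2|) (i, j)).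
Qed.

Lemma norm_le_entry m n (M : 'M[R]_(m, n)) (c : R) :
  0 <= c -> (forall i j, `|M i j| <= c) -> `|M| <= c.
Proof.
move=> c0 Mc; rewrite [leLHS]/Num.Def.normr/= mx_normrE.
by apply: bigmax_le => // -[i j] _; exact: Mc.
Qed.

Lemma cvg_mxP m n (T : Type) (F : set_system T) (FF : Filter F)
    (f : T -> 'M[R]_(m, n)) (l : 'M[R]_(m, n)) :
  (f x @[x --> F] --> l) <-> (forall i j, f x i j @[x --> F] --> l i j).
Proof.
split=> [fl i j|fl].
  apply/cvgrPdist_le => e e0.
  move/cvgrPdist_le: fl => /(_ e e0); apply: filterS => x.
  by apply: le_trans; have := le_entry_norm (l - f x) i j; rewrite !mxE.
apply/cvgrPdist_le => e e0.
suff : \forall x \near F, forall i j, `|l i j - f x i j| <= e.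
  apply: filterS => x lfx; apply: norm_le_entry; first exact: ltW.
  by move=> i j; rewrite !mxE.
apply: filter_forall => i; apply: filter_forall => j.
by move/cvgrPdist_le: (fl i j) => /(_ e e0).
Qed.

Lemma norm_mulmx_le m n p (M : 'M[R]_(m, n)) (N : 'M[R]_(n, p)) :
  `|M *m N| <= n%:R * (`|M| * `|N|).
Proof.
apply: norm_le_entry => [|i j]; first by rewrite !mulr_ge0.
rewrite mxE (le_trans (ler_norm_sum _ _ _))//.
apply: le_trans (_ : \sum_(k < n) (`|M| * `|N|) <= _).
  by apply: ler_sum => k _; rewrite normrM ler_pM// le_entry_norm.
by rewrite sumr_const card_ord mulr_natl.
Qed.

Lemma is_derive_mxP m n (f : R -> 'M[R]_(m, n)) (t : R) (df : 'M[R]_(m, n)) :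
  is_derive t 1 f df <->
  (forall i j, is_derive t 1 (fun s => f s i j) (df i j)).
Proof.
split=> [[fd <-] i j|fd].
  apply: DeriveDef; first exact: (derivable_mxP _ _ _).1 fd i j.
  by rewrite derive_mx// mxE.
have fd' : derivable f t 1.
  by apply/derivable_mxP => i j; apply: ex_derive; exact: fd.
apply: DeriveDef => //; rewrite derive_mx//.
by apply/matrixP => i j; rewrite mxE; apply: derive_val; exact: fd.
Qed.

Lemma is_derive_mulmx m n p (f : R -> 'M[R]_(m, n)) (g : R -> 'M[R]_(n, p))
    (t : R) (df : 'M[R]_(m, n)) (dg : 'M[R]_(n, p)) :
  is_derive t 1 f df -> is_derive t 1 g dg ->
  is_derive t 1 (fun s => f s *m g s) (df *m g t + f t *m dg).
Proof.
move=> /is_derive_mxP fd /is_derive_mxP gd; apply/is_derive_mxP => i j.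
have -> : (fun s => (f s *m g s) i j) =
    \sum_(k < n) ((fun s => f s i k) * (fun s => g s k j)).
  by apply/funext => s; rewrite mxE fct_sumE; apply: eq_bigr.
apply: (@is_derive_eq _ _ _ _ _ _ _ (\sum_(k < n) (f t i k * dg k j + g t k j * df i k))).
  by apply: is_derive_sum => k; apply: is_deriveM.
rewrite !mxE -big_split/=; apply: eq_bigr => k _.
by rewrite addrC [g t k j * _]mulrC.
Qed.

Lemma is_derive_mulmxr m n p (N : 'M[R]_(n, p)) (f : R -> 'M[R]_(m, n))
    (t : R) (df : 'M[R]_(m, n)) :
  is_derive t 1 f df -> is_derive t 1 (fun s => f s *m N) (df *m N).
Proof.
move=> fd; have := is_derive_mulmx fd (is_derive_cst N t 1).
by rewrite mulmx0 addr0.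
Qed.

Lemma is_derive_mulmxl m n p (N : 'M[R]_(m, n)) (f : R -> 'M[R]_(n, p))
    (t : R) (df : 'M[R]_(n, p)) :
  is_derive t 1 f df -> is_derive t 1 (fun s => N *m f s) (N *m df).
Proof.
move=> fd; have := is_derive_mulmx (is_derive_cst N t 1) fd.
by rewrite mul0mx add0r.
Qed.

Lemma is_derive_trmx m n (f : R -> 'M[R]_(m, n)) (t : R) (df : 'M[R]_(m, n)) :
  is_derive t 1 f df -> is_derive t 1 (fun s => (f s)^T) df^T.
Proof.
move=> /is_derive_mxP fd; apply/is_derive_mxP => i j; rewrite mxE.
by under eq_fun do rewrite mxE; exact: fd.
Qed.

Lemma is_derive_mxtrace n (f : R -> 'M[R]_n) (t : R) (df : 'M[R]_n) :
  is_derive t 1 f df -> is_derive t 1 (fun s => \tr (f s)) (\tr df).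
Proof.
move=> /is_derive_mxP fd.
have -> : (fun s => \tr (f s)) = \sum_(k < n) (fun s => f s k k).
  by apply/funext => s; rewrite fct_sumE.
by apply: is_derive_sum => k.
Qed.

Lemma cvg_mulmx m n p (T : Type) (F : set_system T) (FF : Filter F)
    (f : T -> 'M[R]_(m, n)) (g : T -> 'M[R]_(n, p)) (a : 'M[R]_(m, n)) (b : 'M[R]_(n, p)) :
  f x @[x --> F] --> a -> g x @[x --> F] --> b ->
  f x *m g x @[x --> F] --> a *m b.
Proof.
move=> /cvg_mxP fa /cvg_mxP gb; apply/cvg_mxP => i j; rewrite mxE.
under eq_fun do rewrite mxE.
apply: (cvg_big (op := +%R)) => [|k _]; first exact: add_continuous.
exact: cvgM.
Qed.

Lemma cvg_trmx m n (T : Type) (F : set_system T) (FF : Filter F)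
    (f : T -> 'M[R]_(m, n)) (a : 'M[R]_(m, n)) :
  f x @[x --> F] --> a -> (f x)^T @[x --> F] --> a^T.
Proof.
move=> /cvg_mxP fa; apply/cvg_mxP => i j; rewrite mxE.
by under eq_fun do rewrite mxE; exact: fa.
Qed.

Lemma cvg_mxtrace n (T : Type) (F : set_system T) (FF : Filter F)
    (f : T -> 'M[R]_n) (a : 'M[R]_n) :
  f x @[x --> F] --> a -> \tr (f x) @[x --> F] --> \tr a.
Proof. 
move=> /cvg_mxP fa; apply: (cvg_big (op := +%R)) => [|k _].
  exact: add_continuous.
exact: fa.
Qed.

End Entrywise.

(** * The matrix exponential *)

Section Exponential.
Context {R : realType}.

Lemma le_entry_expr n (A : 'M[R]_n) k i j :
  `|(A ^+ k) i j| <= (n%:R * `|A|) ^+ k.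
Proof.
have c0 : 0 <= n%:R * `|A| by rewrite mulr_ge0.
elim: k i j => [|k IH] i j.
  by rewrite !expr0 mxE normr_nat lern1 leq_b1.
rewrite exprS mxE (le_trans (ler_norm_sum _ _ _))//.
apply: le_trans (_ : \sum_(l < n) (`|A| * (n%:R * `|A|) ^+ k) <= _).
  by apply: ler_sum => l _; rewrite normrM ler_pM// le_entry_norm.
by rewrite sumr_const card_ord -[leLHS]mulr_natl exprS -mulrA.
Qed.

(** The entries of [expmx (t *: A)] are power series in [t]; this gives their
coefficients, so that term-by-term differentiation applies to each entry. *)
Definition exp_entry n (A : 'M[R]_n) i j (k : nat) : R :=
  (k`!%:R)^-1 * (A ^+ k) i j.

Lemma is_cvg_pseries_exp_entry n (A : 'M[R]_n) i j (t : R) :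
  cvgn (pseries (exp_entry A i j) t).
Proof.
apply: normed_cvg.
apply: (@series_le_cvg _ _ (exp_coeff (n%:R * `|A| * `|t|))) => [k|k|k|].
- exact: normr_ge0.
- by apply: exp_coeff_ge0; rewrite !mulr_ge0.
- rewrite exp_coeffE /exp_entry /= normrM normrM normfV normr_nat -mulrA.
  rewrite ler_wpM2l ?invr_ge0// exprMn normrX ler_wpM2r ?exprn_ge0//.
  exact: le_entry_expr.
- exact: is_cvg_series_exp_coeff.
Qed.

Lemma exprZmx n (A : 'M[R]_n) (t : R) k : (t *: A) ^+ k = t ^+ k *: A ^+ k.
Proof.
elim: k => [|k IH]; first by rewrite !expr0 scale1r.
by rewrite !exprS IH -![_ * _]/(_ *m _) -scalemxAl -scalemxAr scalerA.
Qed.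

Lemma cvg_expmx n (A : 'M[R]_n) (t : R) :
  series (fun k : nat => (k`!%:R)^-1 *: (t *: A) ^+ k) @ \oo -->
  \matrix_(i, j) limn (pseries (exp_entry A i j) t).
Proof.
apply/cvg_mxP => i j; rewrite mxE.
rewrite (_ : (fun N => _) = pseries (exp_entry A i j) t).
  exact: is_cvg_pseries_exp_entry.
apply/funext => N; rewrite /pseries /series/= summxE; apply: eq_bigr => k _.
by rewrite exprZmx !mxE /exp_entry -mulrA [_ ^+ _ * _]mulrC.
Qed.

Lemma expmxE n (A : 'M[R]_n) (t : R) i j :
  expmx (t *: A) i j = limn (pseries (exp_entry A i j) t).
Proof. by rewrite /expmx (cvg_lim _ (cvg_expmx (A:=A) (t:=t)))// mxE. Qed.

Lemma pseries_diffs_exp_entry n (A : 'M[R]_n) i j :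
  pseries_diffs (exp_entry A i j) =
  (fun k => \sum_(l < n) A i l * exp_entry A l j k).
Proof.
apply/funext => k; rewrite /pseries_diffs /exp_entry factS natrM invfM.
rewrite mulrA mulVKf// exprS mxE mulr_sumr.
by apply: eq_bigr => l _; rewrite mulrCA.
Qed.

Lemma cvg_pseries_sum n (c : 'I_n -> R) (u : 'I_n -> R^nat) (t : R) :
  (forall l, cvgn (pseries (u l) t)) ->
  pseries (fun k => \sum_(l < n) c l * u l k) t @ \oo -->
  \sum_(l < n) c l * limn (pseries (u l) t).
Proof.
move=> ut; have -> : pseries (fun k => \sum_(l < n) c l * u l k) t =
    (fun N => \sum_(l < n) c l * pseries (u l) t N).
  apply/funext => N; rewrite /pseries /series/=.
  under eq_bigr do rewrite mulr_suml.
  rewrite exchange_big/=; apply: eq_bigr => l _; rewrite mulr_sumr.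
  by apply: eq_bigr => k _; rewrite mulrA.
apply: (cvg_big (op := +%R)) => [|l _]; first exact: add_continuous.
by apply: cvgMr; exact: ut.
Qed.

(** Differentiating the coefficients of the [(i, j)] series shifts them by one,
and [A^(k+1) = A A^k] makes the shifted series the combination by row [i] of
[A] of the series in column [j]. *)
Lemma is_derive_expmx n (A : 'M[R]_n) (t : R) :
  is_derive t 1 (fun s => expmx (s *: A)) (A *m expmx (t *: A)).
Proof.
apply/is_derive_mxP => i j; rewrite mxE.
under eq_fun do rewrite expmxE.
under eq_bigr do rewrite expmxE.
have cvgA2 l s : cvgn (pseries (pseries_diffs (exp_entry A l j)) s).
  rewrite pseries_diffs_exp_entry; apply/cvg_ex.
  by eexists; apply: cvg_pseries_sum => k; exact: is_cvg_pseries_exp_entry.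
have cvgA3 s : cvgn (pseries (pseries_diffs (pseries_diffs (exp_entry A i j))) s).
  rewrite pseries_diffs_exp_entry.
  have -> : pseries_diffs (fun k => \sum_(l < n) A i l * exp_entry A l j k) =
      (fun k => \sum_(l < n) A i l * pseries_diffs (exp_entry A l j) k).
    apply/funext => k; rewrite /pseries_diffs mulr_sumr.
    by apply: eq_bigr => l _; rewrite mulrCA.
  by apply/cvg_ex; eexists; exact: cvg_pseries_sum.
rewrite -(cvg_lim _ (cvg_pseries_sum (c := A i)
  (fun l => @is_cvg_pseries_exp_entry _ A l j t)))//.
rewrite -pseries_diffs_exp_entry.
apply: (@pseries_snd_diffs _ _ (`|t| + 1)) => //.
- exact: is_cvg_pseries_exp_entry.
- by rewrite [ltRHS]ger0_norm// ltrDl.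
Qed.

Lemma expmx0 n (A : 'M[R]_n) : expmx (0 *: A) = 1%:M.
Proof.
rewrite /expmx; apply/cvg_lim => //; apply: cvg_near_cst.
near=> N; have N0 : (0 < N)%N by near: N; exists 1%N.
rewrite /series/= big_ltn// expr0 fact0 invr1 scale1r big_nat big1 ?addr0//.
by move=> k /andP[k0 _]; rewrite scale0r expr0n gtn_eqF// scaler0.
Unshelve. all: by end_near. Qed.

Lemma expmx_comm n (A : 'M[R]_n) (t : R) :
  expmx (t *: A) *m A = A *m expmx (t *: A).
Proof.
pose S N := series (fun k : nat => (k`!%:R)^-1 *: (t *: A) ^+ k) N.
have SA : S N @[N --> \oo] --> expmx (t *: A).
  by rewrite /expmx (cvg_lim _ (cvg_expmx (A:=A) (t:=t)))//; exact: cvg_expmx.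
have SlA : S N *m A @[N --> \oo] --> expmx (t *: A) *m A.
  by apply: cvg_mulmx => //; exact: cvg_cst.
have SrA : A *m S N @[N --> \oo] --> A *m expmx (t *: A).
  by apply: cvg_mulmx => //; exact: cvg_cst.
suff SAE N : S N *m A = A *m S N.
  apply: (cvg_unique _ SlA) => //.
  by rewrite (_ : (fun N => _) = (fun N => A *m S N))//; exact/funext.
rewrite /S /series/= mulmx_suml mulmx_sumr.
apply: eq_bigr => k _; rewrite -scalemxAl -scalemxAr exprZmx -scalemxAl -scalemxAr.
by rewrite -![_ *m _]/(_ * _) -exprS -exprSr.
Qed.

Lemma expr_trmx n (A : 'M[R]_n) k : A^T ^+ k = (A ^+ k)^T.
Proof.
elim: k => [|k IH]; first by rewrite !expr0 trmx1.
by rewrite exprS exprSr -![_ * _]/(_ *m _) trmx_mul IH.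
Qed.

Lemma expmx_trmx n (A : 'M[R]_n) (t : R) :
  expmx (t *: A^T) = (expmx (t *: A))^T.
Proof.
apply/matrixP => i j; rewrite mxE !expmxE; congr (limn (pseries _ _)).
by apply/funext => k; rewrite /exp_entry expr_trmx mxE.
Qed.

Lemma expr_block_diag n r (A : 'M[R]_n) (D : 'M[R]_r) k :
  (block_mx A 0 0 D : 'M[R]_(n + r)) ^+ k = block_mx (A ^+ k) 0 0 (D ^+ k).
Proof.
elim: k => [|k IH]; first by rewrite !expr0 -scalar_mx_block.
rewrite !exprS IH -![_ * _]/(_ *m _) mulmx_block.
by rewrite !(mulmx0, mul0mx, addr0, add0r).
Qed.

(** This is what makes the kernels of the error system split. *)
Lemma expmx_block_diag n r (A : 'M[R]_n) (D : 'M[R]_r) (t : R) :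
  expmx (t *: (block_mx A 0 0 D : 'M[R]_(n + r))) =
  block_mx (expmx (t *: A)) 0 0 (expmx (t *: D)).
Proof.
have lim0 : limn (pseries (fun=> 0) t) = 0 :> R.
  apply: lim_near_cst => //; near=> N; rewrite /pseries /series/= big1// => k _.
  by rewrite mul0r.
apply/matrixP => i j; rewrite expmxE.
case: (split_ordP i) => {}i ->; case: (split_ordP j) => {}j ->;
  rewrite ?(block_mxEul, block_mxEur, block_mxEdl, block_mxEdr) ?expmxE ?mxE.
- congr (limn (pseries _ _)); apply/funext => k.
  by rewrite /exp_entry expr_block_diag block_mxEul.
- rewrite -[RHS]lim0; congr (limn (pseries _ _)); apply/funext => k.
  by rewrite /exp_entry expr_block_diag block_mxEur mxE mulr0.
- rewrite -[RHS]lim0; congr (limn (pseries _ _)); apply/funext => k.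
  by rewrite /exp_entry expr_block_diag block_mxEdl mxE mulr0.
- congr (limn (pseries _ _)); apply/funext => k.
  by rewrite /exp_entry expr_block_diag block_mxEdr.
Unshelve. all: by end_near. Qed.

End Exponential.

(** * The Frobenius inner product *)

Section Frobenius.
Context {R : realType}.

Lemma dotFE m n (U V : 'M[R]_(m, n)) :
  dotF U V = \sum_i \sum_j U i j * V i j.
Proof.
rewrite /dotF /mxtrace exchange_big/=; apply: eq_bigr => j _.
by rewrite mxE; apply: eq_bigr => i _; rewrite mxE.
Qed.

Lemma dotF_colE n (x y : 'cV[R]_n) : dotF x y = \sum_i x i 0 * y i 0.
Proof. by rewrite dotFE; apply: eq_bigr => i _; rewrite big_ord1. Qed.

Lemma dotFC m n (U V : 'M[R]_(m, n)) : dotF U V = dotF V U.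
Proof. by rewrite /dotF -mxtrace_tr trmx_mul trmxK. Qed.

Lemma dotFDl m n (U U' V : 'M[R]_(m, n)) : dotF (U + U') V = dotF U V + dotF U' V.
Proof. by rewrite /dotF raddfD/= mulmxDl raddfD. Qed.

Lemma dotFDr m n (U V V' : 'M[R]_(m, n)) : dotF U (V + V') = dotF U V + dotF U V'.
Proof. by rewrite /dotF mulmxDr raddfD. Qed.

Lemma dotFZl m n (c : R) (U V : 'M[R]_(m, n)) : dotF (c *: U) V = c * dotF U V.
Proof. by rewrite /dotF linearZ/= -scalemxAl mxtraceZ. Qed.

Lemma dotFZr m n (c : R) (U V : 'M[R]_(m, n)) : dotF U (c *: V) = c * dotF U V.
Proof. by rewrite /dotF -scalemxAr mxtraceZ. Qed.

Lemma dotFNl m n (U V : 'M[R]_(m, n)) : dotF (- U) V = - dotF U V.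
Proof. by rewrite -scaleN1r dotFZl mulN1r. Qed.

Lemma dotFNr m n (U V : 'M[R]_(m, n)) : dotF U (- V) = - dotF U V.
Proof. by rewrite -scaleN1r dotFZr mulN1r. Qed.

Lemma dotF_mulmxl m n p (W : 'M[R]_(m, n)) (U : 'M[R]_(n, p)) (V : 'M[R]_(m, p)) :
  dotF (W *m U) V = dotF U (W^T *m V).
Proof. by rewrite /dotF trmx_mul mulmxA. Qed.

Lemma dotF_ge0 m n (U : 'M[R]_(m, n)) : 0 <= dotF U U.
Proof.
by rewrite dotFE; apply: sumr_ge0 => i _; apply: sumr_ge0 => j _; rewrite -expr2 sqr_ge0.
Qed.

Lemma dotF_col_mx m1 m2 n (U V : 'M[R]_(m1, n)) (U' V' : 'M[R]_(m2, n)) :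
  dotF (col_mx U U') (col_mx V V') = dotF U V + dotF U' V'.
Proof. by rewrite /dotF tr_col_mx mul_row_col raddfD. Qed.

Lemma sqr_normF m n (U : 'M[R]_(m, n)) : normF U ^+ 2 = dotF U U.
Proof. by rewrite sqr_sqrtr// dotF_ge0. Qed.

Lemma le_entry_dotF m n (U : 'M[R]_(m, n)) i j : (U i j) ^+ 2 <= dotF U U.
Proof.
rewrite dotFE (bigD1 i)//= (bigD1 j)//= expr2 -addrA lerDl addr_ge0//.
  by apply: sumr_ge0 => k _; rewrite -expr2 sqr_ge0.
by apply: sumr_ge0 => k _; apply: sumr_ge0 => l _; rewrite -expr2 sqr_ge0.
Qed.

(** From [2 |x_i x_j| <= x_i^2 + x_j^2]; it compares quadratic forms without
any spectral theory of symmetric matrices. *)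
Lemma quad_le n (N : 'M[R]_n) (x : 'cV[R]_n) :
  dotF x (N *m x) <= n%:R * `|N| * dotF x x.
Proof.
have -> : dotF x (N *m x) = \sum_i \sum_j N i j * (x i 0 * x j 0).
  rewrite dotF_colE; apply: eq_bigr => i _; rewrite mxE mulr_sumr.
  by apply: eq_bigr => j _; rewrite mulrCA.
have -> : n%:R * `|N| * dotF x x =
    \sum_i \sum_j `|N| * (2^-1 * (x i 0 ^+ 2 + x j 0 ^+ 2)).
  have -> : dotF x x = \sum_i x i 0 ^+ 2 by rewrite dotF_colE.
  under [RHS]eq_bigr do rewrite -mulr_sumr -mulr_sumr big_split/= sumr_const card_ord.
  rewrite -[RHS]mulr_sumr -mulr_sumr big_split/= sumr_const card_ord.
  rewrite sumrMnl; set s := \sum_i _.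
  by rewrite -[s *+ n]mulr_natl; field.
apply: ler_sum => i _; apply: ler_sum => j _.
apply: le_trans (ler_norm _) _; rewrite normrM ler_pM ?le_entry_norm//.
have := sqr_ge0 (x i 0 + x j 0); have := sqr_ge0 (x i 0 - x j 0).
by rewrite ler_norml => ? ?; apply/andP; split; lra.
Qed.

End Frobenius.

(** * Quadratic Lyapunov functions and exponential decay *)

Section LyapunovCertificate.
Context {R : realType}.

(** A Lyapunov function [x^T H x] for [x' = A x], with decay rate [2 a].  The
normalization [x^T x <= x^T H x] makes the function control the state and
absorb the perturbation term in [lyapunov_certified_open]. *)
Definition lyapunov_certified n (A : 'M[R]_n) :=
  exists (H : 'M[R]_n) (a : R), [/\ 0 < a, H^T = H,
    forall x : 'cV_n, dotF x x <= dotF x (H *m x) &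
    forall x : 'cV_n, dotF x (H *m (A *m x)) <= - a * dotF x (H *m x)].

Lemma lyapunov_certified_block_diag n r (A : 'M[R]_n) (D : 'M[R]_r) :
  lyapunov_certified A -> lyapunov_certified D ->
  lyapunov_certified (block_mx A 0 0 D : 'M[R]_(n + r)).
Proof.
move=> [H [a [a0 Hsym Hx HA]]] [K [b [b0 Ksym Ky KD]]].
have mul_diag (M1 : 'M[R]_n) (M2 : 'M[R]_r) (x : 'cV[R]_n) (y : 'cV[R]_r) :
    block_mx M1 0 0 M2 *m col_mx x y = col_mx (M1 *m x) (M2 *m y).
  by rewrite mul_block_col !mul0mx addr0 add0r.
exists (block_mx H 0 0 K), (Num.min a b); split.
- by rewrite lt_min a0 b0.
- by rewrite tr_block_mx !trmx0 Hsym Ksym.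
- move=> z; rewrite -(vsubmxK z); set x := usubmx z; set y := dsubmx z.
  by rewrite mul_diag !dotF_col_mx lerD.
- move=> z; rewrite -(vsubmxK z); set x := usubmx z; set y := dsubmx z.
  rewrite !mul_diag !dotF_col_mx.
  have := HA x; have := KD y; have := Hx x; have := Ky y.
  have := dotF_ge0 x; have := dotF_ge0 y.
  move: (dotF x x) (dotF y y) (dotF x _) (dotF y _) (dotF x _) (dotF y _).
  move=> xx yy xHx yKy xHAx yKDy y_ge0 x_ge0 yK xH yKD xHA.
  rewrite mulrDr; apply: lerD.
    by apply: le_trans xHA _; rewrite !mulNr lerN2 ler_wpM2r ?ge_min ?lexx//; lra.
  by apply: le_trans yKD _; rewrite !mulNr lerN2 ler_wpM2r ?ge_min ?lexx ?orbT//; lra.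
Qed.

(** The same [H] serves near [A], at half the rate: the extra term [x^T H D x]
is at most a multiple of [|D| x^T x], hence of [|D| x^T H x]. *)
Lemma lyapunov_certified_open n (A : 'M[R]_n) : lyapunov_certified A ->
  \forall D \near (0 : 'M[R]_n), lyapunov_certified (A + D).
Proof.
move=> [H [a [a0 Hsym Hx HA]]].
pose K := n%:R * (n%:R * `|H|).
have K0 : 0 <= K by rewrite !mulr_ge0.
have d0 : 0 < a / 2 / (K + 1) by rewrite !divr_gt0// ltr_wpDl.
have Dlt := @pseudometric_normed_Zmodule.nbhs0_lt _ 'M[R]_n _ d0.
near=> D; exists H, (a / 2); split => //; first by rewrite divr_gt0.
move=> x; rewrite mulmxDl mulmxDr dotFDr.
have DK : K * `|D| <= a / 2.
  have : `|D| < a / 2 / (K + 1) by near: D; exact: Dlt.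
  rewrite ltr_pdivlMr ?ltr_wpDl// => /ltW; apply: le_trans.
  by rewrite [leRHS]mulrDr mulr1 [K * _]mulrC lerDl.
have HDx : dotF x (H *m (D *m x)) <= a / 2 * dotF x (H *m x).
  rewrite mulmxA; apply: le_trans (quad_le _ _) _.
  apply: ler_pM => //; first exact: dotF_ge0.
  apply: le_trans DK; rewrite /K -!mulrA ler_wpM2l//.
  exact: norm_mulmx_le.
by have := HA x; lra.
Unshelve. all: by end_near. Qed.

Lemma cvg0_of_sqr (T : Type) (F : set_system T) (FF : Filter F) (f : T -> R) :
  f x ^+ 2 @[x --> F] --> (0 : R) -> f x @[x --> F] --> (0 : R).
Proof.
move=> f0; apply/norm_cvg0P.
have -> : (fun x => `|f x|) = (fun x => Num.sqrt (f x ^+ 2)).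
  by apply/funext => x; rewrite sqrtr_sqr.
have := continuous_cvg _ (@sqrt_continuous R 0) f0; rewrite sqrtr0; apply.
Qed.

(** Along a trajectory [x], the derivative of [e^(2 a t) x^T H x] is
nonpositive, so [x^T H x] is at most its initial value times [e^(- 2 a t)], and
it dominates the square of every coordinate.  The trajectory starting at the
[j]-th basis vector is the [j]-th column of the exponential. *)
Lemma expmx_cvg0 n (A : 'M[R]_n) : lyapunov_certified A ->
  expmx (t *: A) @[t --> +oo] --> (0 : 'M[R]_n).
Proof.
move=> [H [a [a0 Hsym Hx HA]]]; apply/cvg_mxP => i j; rewrite mxE.
pose x (t : R) := expmx (t *: A) *m delta_mx j 0 : 'cV[R]_n.
have xE t : expmx (t *: A) i j = x t i 0 by rewrite /x -colE mxE.
under eq_fun do rewrite xE.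
have dx (t : R) : is_derive t 1 x (A *m x t).
  by rewrite /x mulmxA; exact: is_derive_mulmxr (is_derive_expmx A t).
pose V (t : R) := dotF (x t) (H *m x t).
have dV (t : R) : is_derive t 1 V (2 * dotF (x t) (H *m (A *m x t))).
  have HxC y z : dotF y (H *m z) = dotF z (H *m y).
    by rewrite dotFC dotF_mulmxl Hsym.
  have -> : 2 * dotF (x t) (H *m (A *m x t)) =
      \tr ((A *m x t)^T *m (H *m x t) + (x t)^T *m (H *m (A *m x t))).
    rewrite raddfD/= -/(dotF (A *m _) _) -/(dotF (x t) _) [dotF (A *m _) _]HxC.
    by ring.
  apply: is_derive_mxtrace; apply: is_derive_mulmx (is_derive_trmx (dx t)) _.
  exact: is_derive_mulmxl (dx t).
pose g (t : R) := expR (2 * a * t) * V t.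
have dg (t : R) : is_derive t 1 g
    (expR (2 * a * t) * (2 * dotF (x t) (H *m (A *m x t)) + 2 * a * V t)).
  have de : is_derive t 1 (fun s => expR (2 * a * s)) (2 * a * expR (2 * a * t)).
    have dl : is_derive t 1 (fun s => 2 * a * s) (2 * a).
      have := is_deriveZ (2 * a) (is_derive_id t (1 : R)).
      by rewrite /GRing.scale/= mulr1.
    have := is_derive1_comp (is_derive_expR (2 * a * t)) dl.
    by rewrite [expR _ * _]mulrC.
  apply: is_derive_eq (is_deriveM de (dV t)) _.
  by rewrite /GRing.scale/=; ring.
have gle (t : R) : 0 <= t -> g t <= g 0.
  apply: (@ler0_derive1_nincry _ g 0) => //.
  - move=> s _; rewrite derive1E (@derive_val _ _ _ _ _ _ _ (dg s)).
    rewrite pmulr_rle0 ?expR_gt0// /V.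
    by have := HA (x s); lra.
  - apply: continuous_subspaceT => s.
    apply/differentiable_continuous/derivable1_diffP.
    exact: (@ex_derive _ _ _ _ _ _ _ (dg s)).
have Vle (t : R) : 0 <= t -> (x t i 0) ^+ 2 <= V 0 * expR (- (2 * a * t)).
  move=> t0; apply: le_trans (le_entry_dotF _ _ _) _.
  apply: le_trans (Hx _) _; rewrite -/(V t).
  have := gle t t0; rewrite /g mulr0 expR0 mul1r => gt.
  by rewrite expRN ler_pdivlMr ?expR_gt0// mulrC.
apply: cvg0_of_sqr; apply: (@squeeze_cvgr _ _ _ _ (fun=> 0)
  (fun t => V 0 * expR (- (2 * a * t)))).
- near=> t; rewrite sqr_ge0 Vle//.
- exact: cvg_cst.
- have := @cvgMr _ _ _ _ (fun t => expR (- (2 * a * t))) (V 0) 0.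
  rewrite mulr0; apply.
  have lin : 2 * a * t @[t --> +oo] --> +oo.
    by apply: gt0_cvgMry; [rewrite mulr_gt0|exact: cvg_id].
  exact: (cvg_comp _ _ lin (@cvgr_expR R)).
Unshelve. all: by end_near. Qed.

End LyapunovCertificate.

(** * From the spectrum to a Lyapunov function *)

Section Triangular.
Context {R : realType}.

Lemma ReD (z w : R[i]) : complex.Re (z + w) = complex.Re z + complex.Re w.
Proof. by case: z; case: w. Qed.

Lemma ImD (z w : R[i]) : complex.Im (z + w) = complex.Im z + complex.Im w.
Proof. by case: z; case: w. Qed.

Lemma ReM (z w : R[i]) : complex.Re (z * w) =
  complex.Re z * complex.Re w - complex.Im z * complex.Im w.
Proof. by case: z; case: w. Qed.

Lemma ImM (z w : R[i]) : complex.Im (z * w) =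
  complex.Re z * complex.Im w + complex.Im z * complex.Re w.
Proof. by case: z => a b; case: w. Qed.

Let mRe m n (Z : 'M[R[i]]_(m, n)) := map_mx (@complex.Re R) Z.
Let mIm m n (Z : 'M[R[i]]_(m, n)) := map_mx (@complex.Im R) Z.

Lemma map_Re_mulmx m n p (Z : 'M[R[i]]_(m, n)) (W : 'M[R[i]]_(n, p)) :
  mRe (Z *m W) = mRe Z *m mRe W - mIm Z *m mIm W.
Proof.
apply/matrixP => i j; rewrite !mxE (big_morph _ ReD (id1 := 0))// -sumrB.
by apply: eq_bigr => k _; rewrite ReM !mxE.
Qed.

Lemma map_Im_mulmx m n p (Z : 'M[R[i]]_(m, n)) (W : 'M[R[i]]_(n, p)) :
  mIm (Z *m W) = mRe Z *m mIm W + mIm Z *m mRe W.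
Proof.
apply/matrixP => i j; rewrite !mxE (big_morph _ ImD (id1 := 0))// -big_split.
by apply: eq_bigr => k _; rewrite ImM !mxE.
Qed.

(** Schur's theorem; the diagonal of a triangular matrix consists of
eigenvalues. *)
Lemma trig_of_asymp_stable n (A : 'M[R]_n) : (0 < n)%N -> asymp_stable A ->
  exists (P T : 'M[R[i]]_n), [/\ P \in unitmx,
    P *m map_mx (real_complex R) A = T *m P, is_trig_mx T &
    forall i, complex.Re (T i i) < 0].
Proof.
move=> n0 stabA; set Ac := map_mx (real_complex R) A.
have [P Pu Ptrig] := Schur Ac n0; have Punit := unitarymx_unit Pu.
exists P, (P *m Ac *m invmx P); split => //; first by rewrite mulmxKV.
  by have := Ptrig; rewrite /similar_to conjumx.
move=> i; apply: stabA; rewrite -/Ac.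
have [T [TE TP Ttrig]] : exists (T : 'M[R[i]]_n), [/\ T = P *m Ac *m invmx P,
    T *m P = P *m Ac & is_trig_mx T].
  exists (P *m Ac *m invmx P); split; rewrite ?mulmxKV//.
  by have := Ptrig; rewrite /similar_to conjumx.
rewrite -TE.
have : eigenvalue T (T i i).
  rewrite eigenvalue_root_char char_poly_trig//; apply/rootP.
  by rewrite horner_prod (bigD1 i)//= !hornerE subrr mul0r.
move=> /eigenvalueP[v vT v0]; apply/eigenvalueP; exists (v *m P).
  by rewrite -mulmxA -TP mulmxA vT scalemxAl.
by apply: contra_neq v0 => vP; rewrite -(mulmxK Punit v) vP mul0mx.
Qed.

(** Conjugating a lower triangular matrix by [diag (d^i)] multiplies the entry
[(i, j)] by [d^(i - j)]: the diagonal stays, and what is below it shrinks with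
[d]. *)
Lemma near_diag_of_asymp_stable n (A : 'M[R]_n) : (0 < n)%N -> asymp_stable A ->
  exists2 a : R, 0 < a & forall e : R, 0 < e ->
  exists (W T : 'M[R[i]]_n), [/\ W \in unitmx,
    W *m map_mx (real_complex R) A = T *m W,
    forall i, complex.Re (T i i) <= - a &
    forall i j, i != j -> `|complex.Re (T i j)| <= e /\ `|complex.Im (T i j)| <= e].
Proof.
move=> n0 stabA; have [P [T [Pu PA Ttrig Tneg]]] := trig_of_asymp_stable n0 stabA.
pose a := \big[Num.min/1]_i (- complex.Re (T i i)).
have T0 := elimT is_trig_mxP Ttrig.
exists a; first by apply: lt_bigmin => // i _; rewrite oppr_gt0.
move=> e e0; pose K := `|mRe T| + `|mIm T|.
have K0 : 0 <= K by rewrite addr_ge0.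
pose d := Num.min 1 (e / (K + 1)).
have d0 : 0 < d by rewrite lt_min ltr01 divr_gt0// ltr_wpDl.
have d1 : d <= 1 by rewrite ge_min lexx.
have dK : d * K <= e.
  have : d <= e / (K + 1) by rewrite ge_min lexx orbT.
  rewrite ler_pdivlMr ?ltr_wpDl//; apply: le_trans.
  by rewrite ler_wpM2l ?lerDl// ltW.
(* [S] is [D T D^-1], written without the inverse; the truncated subtraction
   is harmless since [T i j = 0] for [i < j]. *)
pose D := diag_mx (\row_(i < n) (d ^+ i)%:C%C).
pose S : 'M[R[i]]_n := \matrix_(i, j) ((d ^+ (i - j)%N)%:C%C * T i j).
have SD : S *m D = D *m T.
  apply/matrixP => i j; rewrite mul_mx_diag mul_diag_mx !mxE.
  have [ij|ji] := ltnP i j; first by rewrite T0// !(mulr0, mul0r).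
  by rewrite mulrAC -rmorphM/= -exprD subnK.
have Dunit : D \in unitmx.
  rewrite unitmxE det_diag unitfE prodf_seq_neq0; apply/allP => i _ /=.
  by rewrite mxE -[0]/((0 : R)%:C%C) (inj_eq (@complexI R)) expf_neq0// gt_eqF.
exists (D *m P), S; split.
- by rewrite unitmx_mul Dunit.
- by rewrite -mulmxA PA !mulmxA SD.
- move=> i; rewrite mxE subnn expr0 mul1r lerNr; exact: bigmin_le.
move=> i j ij; have [lt_ij|] := ltnP i j.
  by rewrite mxE T0// mulr0/= normr0 ltW.
rewrite leq_eqVlt eq_sym (negbTE (_ : i != j :> nat))//= => lt_ji.
have dle : d ^+ (i - j) <= d.
  have := lt_ji; rewrite -subn_gt0; case: (i - j)%N => // k _.
  by rewrite exprS ler_piMr ?exprn_ile1// ltW.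
have dn0 : 0 <= d ^+ (i - j) by rewrite exprn_ge0// ltW.
have bound (x y : R) : x = d ^+ (i - j) * y -> `|y| <= K -> `|x| <= e.
  move=> -> yK; rewrite normrM ger0_norm//.
  by apply: le_trans dK; rewrite ler_pM.
split; rewrite mxE.
- apply: (bound _ (complex.Re (T i j))); first by rewrite ReM/= mul0r subr0.
  apply: le_trans (_ : `|mRe T| <= _); last by rewrite lerDl.
  by have := le_entry_norm (mRe T) i j; rewrite mxE.
- apply: (bound _ (complex.Im (T i j))); first by rewrite ImM/= mul0r addr0.
  apply: le_trans (_ : `|mIm T| <= _); last by rewrite lerDr.
  by have := le_entry_norm (mIm T) i j; rewrite mxE.
Qed.

(** If [y = Y x] follows a flow [y' = T y] along which [y^T y] decays, then a
multiple of [x^T Y^T Y x] is a Lyapunov function for [x].  The dimension [k]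
may exceed that of [A]: it is twice as large when [y] holds the real and
imaginary parts of complex coordinates. *)
Lemma lyapunov_certified_dissipative n k (A : 'M[R]_n) (Y : 'M[R]_(k, n))
    (N : 'M[R]_(n, k)) (T : 'M[R]_k) (a : R) :
  0 < a -> N *m Y = 1%:M -> Y *m A = T *m Y ->
  (forall y : 'cV_k, dotF y (T *m y) <= - a * dotF y y) ->
  lyapunov_certified A.
Proof.
move=> a0 NY YA Ta; pose K := k%:R * `|N^T *m N| + 1.
have K0 : 0 < K by rewrite ltr_wpDl// mulr_ge0.
have HE (x y : 'cV[R]_n) : dotF x (K *: (Y^T *m Y) *m y) = K * dotF (Y *m x) (Y *m y).
  by rewrite -scalemxAl dotFZr dotF_mulmxl mulmxA.
exists (K *: (Y^T *m Y)), a; split => //.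
- by rewrite linearZ/= trmx_mul trmxK.
- move=> x; rewrite HE; set y := Y *m x.
  have -> : x = N *m y by rewrite /y mulmxA NY mul1mx.
  rewrite dotF_mulmxl mulmxA; apply: le_trans (quad_le _ _) _.
  by rewrite ler_wpM2r ?dotF_ge0// lerDl.
- move=> x; rewrite !HE [Y *m (A *m x)]mulmxA YA -mulmxA mulrCA.
  by rewrite ler_pM2l.
Qed.

(** In the coordinates of an almost triangularizing basis, the derivative of
the sum of the squared moduli is at most [- 2 a] times this sum from the
diagonal, plus off-diagonal terms that the choice of [e] keeps below half
of that. *)
Lemma lyapunov_certified_of_asymp_stable n (A : 'M[R]_n) :
  asymp_stable A -> lyapunov_certified A.
Proof.
case: n A => [|n] A stabA.
  have dot0 (x y : 'cV[R]_0) : dotF x y = 0 by rewrite dotF_colE big_ord0.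
  exists 0, 1; split; rewrite ?trmx0// => x; rewrite !dot0 ?mulr0//.
have [a a0 /(_ (a / (4 * n.+1%:R)))] := near_diag_of_asymp_stable (ltn0Sn n) stabA.
(* The pairs [(i, j)] contribute at most [e (s i + s j)] each, in total
   [2 N e] times the sum of [s] for a dimension [N], which is [a / 2] times it. *)
set e := a / _; have e0 : 0 < e by rewrite divr_gt0// mulr_gt0.
move=> /(_ e0)[W [T [Wu WA Tdiag Toff]]].
pose Y := col_mx (mRe W) (mIm W).
pose N := row_mx (mRe (invmx W)) (- mIm (invmx W)).
pose T' := block_mx (mRe T) (- mIm T) (mIm T) (mRe T).
have mReA : mRe (map_mx (real_complex R) A) = A by apply/matrixP => i j; rewrite !mxE.
have mImA : mIm (map_mx (real_complex R) A) = 0 by apply/matrixP => i j; rewrite !mxE.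
apply: (@lyapunov_certified_dissipative _ _ A Y N T' (a / 2)).
- by rewrite divr_gt0.
- rewrite mul_row_col mulNmx -map_Re_mulmx mulVmx//.
  by apply/matrixP => i j; rewrite !mxE; case: (i == j).
- rewrite mul_col_mx mul_block_col mulNmx [mIm T *m _ + _]addrC.
  rewrite -map_Re_mulmx -map_Im_mulmx -WA map_Re_mulmx map_Im_mulmx.
  by rewrite mReA mImA !mulmx0 subr0 add0r.
move=> y; rewrite -(vsubmxK y); set u := usubmx y; set v := dsubmx y.
rewrite mul_block_col !dotF_col_mx mulNmx.
pose s i := u i 0 ^+ 2 + v i 0 ^+ 2.
have s0 i : 0 <= s i by rewrite addr_ge0// sqr_ge0.
have -> : dotF u u + dotF v v = \sum_i s i.
  by rewrite !dotF_colE -big_split; apply: eq_bigr => i _; rewrite /= -!expr2.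
have -> : dotF u (mRe T *m u - mIm T *m v) + dotF v (mIm T *m u + mRe T *m v) =
    \sum_i \sum_j (complex.Re (T i j) * (u i 0 * u j 0 + v i 0 * v j 0)
      + complex.Im (T i j) * (v i 0 * u j 0 - u i 0 * v j 0)).
  rewrite !dotF_colE -big_split; apply: eq_bigr => i _ /=.
  rewrite !mxE -sumrB -big_split !mulr_sumr -big_split; apply: eq_bigr => j _ /=.
  by rewrite !mxE; ring.
have sumE (f : 'I_n.+1 -> R) : - (a / 2) * \sum_i f i =
    \sum_i \sum_j ((i == j)%:R * (- a * f i) + e * (f i + f j)).
  have E i : \sum_j ((i == j)%:R * (- a * f i) + e * (f i + f j)) =
      - a * f i + e * (f i *+ n.+1 + \sum_j f j).
    rewrite big_split/= -mulr_sumr big_split/= sumr_const card_ord.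
    rewrite (bigD1 i)//= eqxx mul1r [\sum_(_ < _ | _) _]big1 ?addr0// => j.
    by move=> /negbTE; rewrite eq_sym => ->; rewrite mul0r.
  rewrite (eq_bigr _ (fun i _ => E i)) big_split/=.
  rewrite -[\sum_i - a * _]mulr_sumr -[\sum_i e * _]mulr_sumr.
  rewrite big_split/= sumrMnl sumr_const card_ord.
  set S := \sum_i f i.
  by rewrite -[S *+ _]mulr_natl /e; field; rewrite nat1r pnatr_eq0.
rewrite sumE.
apply: ler_sum => i _; apply: ler_sum => j _.
have [->|ij] := eqVneq i j.
  have sj := s0 j; have ej : 0 <= e * (s j + s j).
    by apply: mulr_ge0; [exact: ltW|exact: addr_ge0].
  have Tj : complex.Re (T j j) * s j <= - a * s j by rewrite ler_wpM2r.
  by rewrite mul1r; move: ej Tj; rewrite /s; lra.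
have [] := Toff i j ij; rewrite mul0r add0r /s.
move: (complex.Re _) (complex.Im _) (u i 0) (u j 0) (v i 0) (v j 0) => b c p q x z.
have prod_le (t w : R) : `|t| <= e -> t * w <= e * `|w|.
  by move=> te; apply: le_trans (ler_norm _) _; rewrite normrM ler_wpM2r.
move=> /prod_le be /prod_le ce; apply: le_trans (lerD (be _) (ce _)) _.
rewrite -mulrDr ler_wpM2l ?(ltW e0)//.
have := sqr_ge0 (p - q); have := sqr_ge0 (p + q).
have := sqr_ge0 (x - z); have := sqr_ge0 (x + z).
have := sqr_ge0 (x - q); have := sqr_ge0 (x + q).
have := sqr_ge0 (p - z); have := sqr_ge0 (p + z).
do 8 move=> ?.
have : `|p * q + x * z| <= (p ^+ 2 + q ^+ 2 + x ^+ 2 + z ^+ 2) / 2.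
  by rewrite ler_norml; apply/andP; split; lra.
have : `|x * q - p * z| <= (p ^+ 2 + q ^+ 2 + x ^+ 2 + z ^+ 2) / 2.
  by rewrite ler_norml; apply/andP; split; lra.
lra.
Qed.

End Triangular.

(** * Sylvester and Lyapunov equations *)

Section Sylvester.
Context {R : realType}.

(** The form in which stability enters the integrals and the Sylvester
equations. *)
Definition expmx_vanishes n (A : 'M[R]_n) :=
  expmx (t *: A) @[t --> +oo] --> (0 : 'M[R]_n).

Lemma expmx_vanishes_trmx n (A : 'M[R]_n) :
  expmx_vanishes A -> expmx_vanishes A^T.
Proof.
move=> A0; rewrite /expmx_vanishes -trmx0.
by under eq_fun do rewrite expmx_trmx; apply: cvg_trmx.
Qed.

(** With [D] transposed, the operator is the infinitesimal form of
[X |-> e^(tA) X (e^(tD))^T], and [A = D] gives the Lyapunov operator. *)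
Definition sylvester n r (A : 'M[R]_n) (D : 'M[R]_r) (X : 'M[R]_(n, r)) :=
  A *m X + X *m D^T.

Lemma sylvester_is_linear n r (A : 'M[R]_n) (D : 'M[R]_r) :
  linear (sylvester A D).
Proof.
move=> c X Y; rewrite /sylvester mulmxDr mulmxDl -scalemxAl -scalemxAr.
by rewrite scalerDr addrACA.
Qed.

HB.instance Definition _ n r (A : 'M[R]_n) (D : 'M[R]_r) :=
  GRing.isLinear.Build R 'M[R]_(n, r) 'M[R]_(n, r) *:%R (sylvester A D)
    (sylvester_is_linear A D).

Lemma is_derive_sylvester n r (A : 'M[R]_n) (D : 'M[R]_r) (X : 'M[R]_(n, r)) (t : R) :
  is_derive t 1 (fun s => expmx (s *: A) *m X *m (expmx (s *: D))^T)
    (expmx (t *: A) *m sylvester A D X *m (expmx (t *: D))^T).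
Proof.
have dA := is_derive_mulmxr X (is_derive_expmx A t).
have := is_derive_mulmx dA (is_derive_trmx (is_derive_expmx D t)).
by rewrite -!expmx_comm trmx_mul /sylvester mulmxDr mulmxDl !mulmxA.
Qed.

Lemma cvg_sylvester n r (A : 'M[R]_n) (D : 'M[R]_r) (X : 'M[R]_(n, r)) :
  expmx_vanishes A -> expmx_vanishes D ->
  expmx (t *: A) *m X *m (expmx (t *: D))^T @[t --> +oo] --> (0 : 'M[R]_(n, r)).
Proof.
move=> A0 D0; have := cvg_mulmx _ (cvg_mulmx _ A0 (cvg_cst X)) (cvg_trmx _ D0).
by rewrite !mul0mx; apply.
Qed.

(** On the kernel, [e^(tA) X (e^(tD))^T] is constant in [t]; it starts at [X]
and tends to 0. *)
Lemma sylvester_inj n r (A : 'M[R]_n) (D : 'M[R]_r) (X : 'M[R]_(n, r)) :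
  expmx_vanishes A -> expmx_vanishes D -> sylvester A D X = 0 -> X = 0.
Proof.
move=> A0 D0 X0; have := cvg_sylvester X A0 D0.
pose F (t : R) := expmx (t *: A) *m X *m (expmx (t *: D))^T.
have FX : F 0 = X by rewrite /F !expmx0 mul1mx trmx1 mulmx1.
rewrite -/F (_ : F = cst X); last first.
  apply/funext => t; apply/matrixP => i j; rewrite /cst -[in RHS]FX.
  apply: (@is_derive_0_is_cst _ (fun s => F s i j)) => s.
  have := is_derive_sylvester A D X s.
  by rewrite X0 mulmx0 mul0mx => /is_derive_mxP/(_ i j); rewrite mxE.
by move=> /(cvg_unique _ (cvg_cst X)) ->.
Qed.

Lemma norm_mxvec_le n r (X : 'M[R]_(n, r)) : `|mxvec X| <= `|X|.
Proof.
apply: norm_le_entry => // i k; rewrite ord1.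
by case/mxvec_indexP: k => a b; rewrite mxvecE le_entry_norm.
Qed.

Lemma norm_vec_mx_le n r (v : 'rV[R]_(n * r)) : `|vec_mx v| <= `|v|.
Proof. by apply: norm_le_entry => // i j; rewrite mxE le_entry_norm. Qed.

(** An injective endomorphism of a finite-dimensional space is invertible, and
as a matrix its inverse is bounded. *)
Lemma sylvester_bounded_inverse n r (A : 'M[R]_n) (D : 'M[R]_r) :
  expmx_vanishes A -> expmx_vanishes D ->
  exists (S : 'M[R]_(n, r) -> 'M[R]_(n, r)) (K : R),
    [/\ 0 <= K, forall V, sylvester A D (S V) = V &
        forall X, `|X| <= K * `|sylvester A D X|].
Proof.
move=> A0 D0; pose L := lin_mx (sylvester A D : 'M[R]_(n, r) -> 'M[R]_(n, r)).
have Lu : L \in unitmx.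
  rewrite -row_free_unit -kermx_eq0; apply/eqP/row_matrixP => i.
  rewrite row0; set v := row i _.
  have : v *m L = 0 by rewrite -row_mul mulmx_ker row0.
  rewrite mul_rV_lin => vL; rewrite -[v]vec_mxK.
  rewrite (sylvester_inj A0 D0 (X := vec_mx v)) ?linear0//.
  by rewrite -[LHS]mxvecK vL linear0.
exists (fun V => vec_mx (mxvec V *m invmx L)), ((n * r)%:R * `|invmx L|).
split=> [|V|X]; first by rewrite mulr_ge0.
  by rewrite -[LHS]mxvecK -mul_rV_lin mulmxKV// mxvecK.
have -> : `|X| = `|vec_mx (mxvec (sylvester A D X) *m invmx L)|.
  by rewrite -mul_vec_lin mulmxK// mxvecK.
apply: le_trans (norm_vec_mx_le _) _; apply: le_trans (norm_mulmx_le _ _) _.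
by rewrite -mulrA [`|invmx L| * _]mulrC ler_wpM2l// ler_wpM2r// norm_mxvec_le.
Qed.

Lemma sylvester_unique n r (A : 'M[R]_n) (D : 'M[R]_r) (V : 'M[R]_(n, r)) :
  expmx_vanishes A -> expmx_vanishes D ->
  exists X, unique (fun Y => sylvester A D Y + V = 0) X.
Proof.
move=> A0 D0; have [S [K [_ SV _]]] := sylvester_bounded_inverse A0 D0.
exists (S (- V)); split; first by rewrite SV addNr.
move=> Y /eqP; rewrite addr_eq0 => /eqP YV; apply/eqP; rewrite -subr_eq0; apply/eqP.
by apply: sylvester_inj A0 D0 _; rewrite linearB/= SV YV subrr.
Qed.

Lemma dotF_sylvester n r (A : 'M[R]_n) (D : 'M[R]_r) (Y X : 'M[R]_(n, r)) :
  dotF (sylvester A^T D^T Y) X = dotF Y (sylvester A D X).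
Proof.
rewrite /sylvester dotFDl dotFDr dotF_mulmxl !trmxK; congr (_ + _).
by rewrite /dotF trmx_mul -mulmxA mxtrace_mulC mulmxA.
Qed.

End Sylvester.

(** * The H2 norm in terms of the Gramian *)

Section GramianIntegral.
Context {R : realType}.
Variables (n m : nat) (A : 'M[R]_n) (B : 'M[R]_(n, m)) (P : 'M[R]_n).
Hypotheses (A0 : expmx_vanishes A) (AP : sylvester A A P + B *m B^T = 0).

(** The Lyapunov equation for [P] says that [- tr (W e^(tA) P (e^(tA))^T)] is a
primitive of [f].  Nonnegativity of [f] spares any integrability argument in
the improper fundamental theorem of calculus. *)
Lemma integral_gramian (W : 'M[R]_n) (f : R -> R) :
  (forall t, 0 <= t -> 0 <= f t) ->
  (forall t, f t = \tr (W *m (expmx (t *: A) *m B *m (expmx (t *: A) *m B)^T))) ->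
  (\int[lebesgue_measure]_(t in `[0%R, +oo[) (f t)%:E = (\tr (W *m P))%:E)%E.
Proof.
move=> f0 fE.
pose F t := - \tr (W *m (expmx (t *: A) *m P *m (expmx (t *: A))^T)).
have dF (t : R) : is_derive t 1 F (f t).
  have -> : f t = - \tr (W *m (expmx (t *: A) *m sylvester A A P *m (expmx (t *: A))^T)).
    rewrite fE; move/eqP: AP; rewrite addr_eq0 => /eqP ->.
    by rewrite mulmxN mulNmx mulmxN raddfN opprK trmx_mul !mulmxA.
  apply: is_deriveN; apply: is_derive_mxtrace; apply: is_derive_mulmxl.
  exact: is_derive_sylvester.
have cF : continuous F.
  move=> t; apply/differentiable_continuous/derivable1_diffP.
  exact: (@ex_derive _ _ _ _ _ _ _ (dF t)).
have cE : continuous (fun t : R => expmx (t *: A)).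
  move=> t; apply/differentiable_continuous/derivable1_diffP.
  exact: (@ex_derive _ _ _ _ _ _ _ (is_derive_expmx A t)).
have cf : continuous f.
  move=> t; rewrite /continuous_at (funext fE) /=; apply: cvg_mxtrace.
  apply: cvg_mulmx; first exact: cvg_cst.
  apply: cvg_mulmx; last apply: cvg_trmx.
    by apply: cvg_mulmx; [exact: cE|exact: cvg_cst].
  by apply: cvg_mulmx; [exact: cE|exact: cvg_cst].
rewrite (@ge0_continuous_FTC2y _ f F 0 0)//.
- by rewrite /F expmx0 trmx1 mulmx1 mul1mx sub0e EFinN oppeK.
- exact: continuous_subspaceT.
- have := cvg_mxtrace _ (cvg_mulmx _ (cvg_cst W) (cvg_sylvester P A0 A0)).
  rewrite mulmx0 raddf0 => h; rewrite -oppr0; apply: cvgN; exact: h.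
- by apply: cvg_at_right_filter; exact: cF.
- by move=> t _; rewrite derive1E (@derive_val _ _ _ _ _ _ _ (dF t)).
Qed.

End GramianIntegral.

Section KroneckerIndex.

(** The pairing of indices in [mxvec] is an enumeration rank, and the one in the
tensor product is arithmetic; both are lexicographic, which
[mxvec_index_mxtens] records. *)
Lemma index_allpairs (S T : eqType) (s : seq S) (t : seq T) x y :
  x \in s -> y \in t ->
  index (x, y) [seq (a, b) | a <- s, b <- t] = (index x s * size t + index y t)%N.
Proof.
move=> + yt; elim: s => //= a s IH; rewrite inE index_cat.
have pair_inj (c : S) : injective (pair c : T -> S * T) by move=> ? ? [].
have [<- _|xa /=] := eqVneq x a.
  by rewrite map_f// index_map.
move=> /IH ->; rewrite size_map mulSn addnA.
by case: ifP => // /mapP[b _ [xE]]; rewrite xE eqxx in xa.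
Qed.

Lemma mxvec_index_mxtens m n (i : 'I_m) (j : 'I_n) :
  mxvec_index i j = @mxtens_index _ _ (i, j).
Proof.
apply: val_inj; rewrite /= /enum_rank enum_rank_in.unlock insubdK; last first.
  by rewrite unfold_in/= cardE index_mem mem_enum.
have -> : enum {: 'I_m * 'I_n} = [seq (a, b) | a <- enum 'I_m, b <- enum 'I_n].
  by rewrite enumT unlock.
by rewrite index_allpairs ?mem_enum// !index_enum_ord size_enum_ord.
Qed.

Lemma sum_mxtens (V : nmodType) m n (F : 'I_(m * n) -> V) :
  \sum_l F l = \sum_i \sum_j F (@mxtens_index m n (i, j)).
Proof.
rewrite pair_bigA (reindex (@mxtens_index m n))/=; last first.
  by exists (@mxtens_unindex m n) => ij _; rewrite (mxtens_indexK, mxtens_unindexK).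
by apply: eq_bigr => -[].
Qed.

End KroneckerIndex.

Section H2Norm.
Context {R : realType} {m p : nat}.

(** Unfolds [vec] and the Kronecker product: row [k] of the second kernel lists
the entries of the bilinear form [M_k] between columns of [e^(sA) B] and
[e^(tA) B]. *)
Lemma kernel2E n (S : lqo R n m p) (s t : R) k a b :
  kernel2 S s t k (@mxtens_index _ _ (a, b)) =
  ((expmx (t *: lqoA S) *m lqoB S)^T *m lqoM S k *m
   (expmx (s *: lqoA S) *m lqoB S)) b a.
Proof.
rewrite /kernel2.
move: (expmx (s *: _) *m _) (expmx (t *: _) *m _) => E1 E2.
rewrite mxE sum_mxtens mxE; apply: eq_bigr => i _.
rewrite mxE mulr_suml; apply: eq_bigr => j _.
by rewrite !mxE !mxtens_indexK/= -mxvec_index_mxtens mxvecE mxE; ring.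
Qed.

Lemma sqr_normF_kernel2 n (S : lqo R n m p) (s t : R) :
  normF (kernel2 S s t) ^+ 2 = \sum_(k < p)
    dotF ((expmx (t *: lqoA S) *m lqoB S)^T *m lqoM S k *m
          (expmx (s *: lqoA S) *m lqoB S))
         ((expmx (t *: lqoA S) *m lqoB S)^T *m lqoM S k *m
          (expmx (s *: lqoA S) *m lqoB S)).
Proof.
rewrite sqr_normF dotFE; apply: eq_bigr => k _; rewrite dotFE exchange_big/=.
rewrite sum_mxtens.
by apply: eq_bigr => a _; apply: eq_bigr => b _; rewrite !kernel2E.
Qed.

Lemma dotF_trmx_mulmx n q (U : 'M[R]_(n, q)) (X : 'M[R]_(n, m)) :
  dotF (U^T *m X) (U^T *m X) = \tr (X *m X^T *m (U *m U^T)).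
Proof.
by rewrite /dotF trmx_mul trmxK mxtrace_mulC !mulmxA [RHS]mxtrace_mulC !mulmxA.
Qed.

(** The squared H2 norm when [P] is the reachability Gramian of [S]. *)
Definition gramian_cost n (S : lqo R n m p) (P : 'M[R]_n) : R :=
  \tr ((lqoC S)^T *m lqoC S *m P) +
  \tr ((\sum_(k < p) (lqoM S k)^T *m P *m lqoM S k) *m P).

(** The inner integral is [integral_gramian] with a weight that depends on the
outer time [s]; moving [E s] to the other side of the trace exhibits the outer
integrand in the form required by [integral_gramian] again. *)
Lemma H2norm_gramian n (S : lqo R n m p) (P : 'M[R]_n) :
  expmx_vanishes (lqoA S) ->
  sylvester (lqoA S) (lqoA S) P + lqoB S *m (lqoB S)^T = 0 ->
  ((\int[lebesgue_measure]_(t in `[0%R, +oo[) (normF (kernel1 S t) ^+ 2)%:E)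
   + (\int[lebesgue_measure]_(t1 in `[0%R, +oo[)
      \int[lebesgue_measure]_(t2 in `[0%R, +oo[)
        (normF (kernel2 S t1 t2) ^+ 2)%:E) = (gramian_cost S P)%:E)%E.
Proof.
move=> A0 AP; pose E (t : R) := expmx (t *: lqoA S) *m lqoB S.
have integral_lin (W : 'M[R]_n) (f : R -> R) : (forall t, 0 <= t -> 0 <= f t) ->
    (forall t, f t = \tr (W *m (E t *m (E t)^T))) ->
    (\int[lebesgue_measure]_(t in `[0%R, +oo[) (f t)%:E = (\tr (W *m P))%:E)%E.
  exact: integral_gramian A0 AP W f.
have -> := integral_lin ((lqoC S)^T *m lqoC S); last first.
- move=> t; rewrite sqr_normF /kernel1 -mulmxA -/(E t) /dotF trmx_mul.
  by rewrite -!mulmxA mxtrace_mulC !mulmxA.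
- by move=> t _; rewrite sqr_ge0.
pose W2 s := \sum_(k < p) lqoM S k *m E s *m (E s)^T *m (lqoM S k)^T.
have inner s : (\int[lebesgue_measure]_(t in `[0%R, +oo[)
    (normF (kernel2 S s t) ^+ 2)%:E = (\tr (W2 s *m P))%:E)%E.
  apply: integral_lin => [t _|t]; first by rewrite sqr_ge0.
  rewrite sqr_normF_kernel2 /W2 mulmx_suml raddf_sum/=; apply: eq_bigr => k _.
  rewrite -/(E s) -/(E t) -mulmxA dotF_trmx_mulmx.
  by move: (E s) (E t) (lqoM S k) => Es Et N; rewrite trmx_mul !mulmxA.
under eq_integral do rewrite inner.
have -> := integral_lin (\sum_(k < p) (lqoM S k)^T *m P *m lqoM S k); last first.
- move=> s; rewrite /W2 !mulmx_suml !raddf_sum/=; apply: eq_bigr => k _.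
  rewrite -[_ *m (lqoM S k)^T *m P]mulmxA mxtrace_mulC.
  by rewrite !mulmxA.
- move=> s _; rewrite -lee_fin -inner; apply: integral_ge0 => t _.
  by rewrite lee_fin sqr_ge0.
by rewrite -EFinD.
Qed.

End H2Norm.

(** * The error system *)

Section ErrorSystem.
Context {R : realType} {m p n r : nat}.
Variables (S : lqo R n m p) (Sr : lqo R r m p).

Definition error_system : lqo R (n + r) m p :=
  LQO (block_mx (lqoA S) 0 0 (lqoA Sr)) (col_mx (lqoB S) (lqoB Sr))
      (row_mx (lqoC S) (- lqoC Sr))
      (fun k => block_mx (lqoM S k) 0 0 (- lqoM Sr k)).

Lemma kernel1_error_system t :
  kernel1 error_system t = kernel1 S t - kernel1 Sr t.
Proof.
rewrite /kernel1 /= expmx_block_diag mul_row_block !mulmx0 addr0 add0r.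
by rewrite mul_row_col !mulNmx.
Qed.

Lemma kernel2_error_system s t :
  kernel2 error_system s t = kernel2 S s t - kernel2 Sr s t.
Proof.
apply/matrixP => k l; rewrite [RHS]mxE [X in _ + X]mxE.
case: (mxtens_indexP l) => a b; rewrite !kernel2E/= !expmx_block_diag.
move: (expmx _) (expmx _) (expmx _) (expmx _) => Et Etr Es Esr.
rewrite !mul_block_col !mul0mx !addr0 !add0r tr_col_mx mul_row_block.
by rewrite !mulmx0 addr0 add0r mul_row_col mulmxN mulNmx !mxE.
Qed.

Lemma H2err2_gramian (P : 'M[R]_(n + r)) :
  expmx_vanishes (lqoA error_system) ->
  sylvester (lqoA error_system) (lqoA error_system) P
    + lqoB error_system *m (lqoB error_system)^T = 0 ->
  H2err2 S Sr = gramian_cost error_system P.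
Proof.
move=> A0 AP; rewrite /H2err2 /H2err2_ereal.
under eq_integral do rewrite -kernel1_error_system.
under [X in (_ + X)%E]eq_integral do
  under eq_integral do rewrite -kernel2_error_system.
by rewrite (H2norm_gramian A0 AP).
Qed.

End ErrorSystem.

(** * Gradients from quadratic remainders *)

Section Gradient.
Context {R : realType}.

Lemma norm_dotF_le m n (U V : 'M[R]_(m, n)) :
  `|dotF U V| <= (m * n)%:R * (`|U| * `|V|).
Proof.
rewrite dotFE; apply: le_trans (ler_norm_sum _ _ _) _.
apply: le_trans (_ : \sum_(i < m) \sum_(j < n) (`|U| * `|V|) <= _).
  apply: ler_sum => i _; apply: le_trans (ler_norm_sum _ _ _) _.
  by apply: ler_sum => j _; rewrite normrM ler_pM// le_entry_norm.
by rewrite !sumr_const !card_ord -mulrnA mulnC mulr_natl.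
Qed.

Lemma le_norm_normF m n (U : 'M[R]_(m, n)) : `|U| <= normF U.
Proof.
apply: norm_le_entry => [|i j]; first exact: sqrtr_ge0.
by rewrite -sqrtr_sqr ler_sqrt ?dotF_ge0// le_entry_dotF.
Qed.

Lemma normFZ m n (c : R) (U : 'M[R]_(m, n)) : 0 <= c -> normF (c *: U) = c * normF U.
Proof.
move=> c0; rewrite /normF dotFZl dotFZr mulrA sqrtrM ?mulr_ge0//.
by rewrite -expr2 sqrtr_sqr ger0_norm.
Qed.

Lemma normF_gt0 m n (U : 'M[R]_(m, n)) : U != 0 -> 0 < normF U.
Proof. by move=> U0; apply: lt_le_trans (le_norm_normF U); rewrite normr_gt0. Qed.

(** The quadratic bound is stronger than what differentiability asks for, and
is what all the expansions below provide.  Uniqueness: two gradients differ by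
an [H] with [<H, D>] negligible before [|D|], and [D = t H] shows that [H] has
norm 0. *)
Lemma is_gradient_quadratic m n (f : 'M[R]_(m, n) -> R) (Y G : 'M[R]_(m, n)) :
  (exists K, \forall D \near (0 : 'M[R]_(m, n)),
     `|f (Y + D) - f Y - dotF G D| <= K * `|D| ^+ 2) ->
  is_gradient f Y G.
Proof.
move=> [K fK].
have fG : (f (Y + D) - f Y - dotF G D) / normF D @[D --> (0 : 'M[R]_(m, n))^']
    --> (0 : R).
  apply/cvgrPdist_le => e e0.
  have d0 : 0 < e / (`|K| + 1) by rewrite divr_gt0// ltr_wpDl.
  have Dlt := @dnbhs0_lt _ 'M[R]_(m, n) _ d0.
  have fK' : \forall D \near (0 : 'M[R]_(m, n))^',
      `|f (Y + D) - f Y - dotF G D| <= K * `|D| ^+ 2 by exact: nbhs_dnbhs.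
  near=> D; rewrite sub0r normrN normrM normfV.
  have D0 : D != 0 by near: D; exact: nbhs_dnbhs_neq.
  have nD := normF_gt0 D0.
  rewrite [`|normF D|]gtr0_norm// ler_pdivrMr//.
  apply: le_trans (_ : K * `|D| ^+ 2 <= _); first by near: D; exact: fK'.
  apply: le_trans (_ : e * `|D| <= _); last by rewrite ler_wpM2l ?le_norm_normF// ltW.
  rewrite expr2 mulrA ler_wpM2r//.
  have : `|D| < e / (`|K| + 1) by near: D; exact: Dlt.
  rewrite ltr_pdivlMr ?ltr_wpDl// mulrDr mulr1 => De.
  apply: le_trans (_ : `|K| * `|D| <= e); first by rewrite ler_wpM2r// ler_norm.
  by rewrite mulrC; have := normr_ge0 D; lra.
split; first exact: fG.
move=> G' fG'; apply/eqP/negPn/negP => GG'.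
pose H := G - G'; have H0 : H != 0 by rewrite subr_eq0.
have nH := normF_gt0 H0.
have HD : dotF H D / normF D @[D --> (0 : 'M[R]_(m, n))^'] --> (0 : R).
  rewrite -[X in _ --> X](subrr 0).
  have -> : (fun D => dotF H D / normF D) = (fun D : 'M[R]_(m, n) =>
      (f (Y + D) - f Y - dotF G' D) / normF D - (f (Y + D) - f Y - dotF G D) / normF D).
    apply/funext => D; rewrite -mulrBl /H dotFDl dotFNl; congr (_ / _); ring.
  exact: cvgB.
have tH : t *: H @[t --> (0 : R)^'+] --> (0 : 'M[R]_(m, n))^'.
  have tH0 : t *: H @[t --> (0 : R)^'+] --> (0 : 'M[R]_(m, n)).
    rewrite -[X in _ --> X](scale0r H).
    by apply: cvg_at_right_filter; apply: cvgZr_tmp; exact: cvg_id.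
  move=> P /tH0; apply: filterS2 (nbhs_right_gt 0) => t t0; apply.
  by rewrite scaler_eq0 gt_eqF.
have := cvg_comp _ _ tH HD.
have HH : \forall t \near (0 : R)^'+, dotF H (t *: H) / normF (t *: H) = normF H.
  apply: filterS (nbhs_right_gt 0) => t t0.
  rewrite dotFZr normFZ ?ltW// -mulf_div divff ?gt_eqF// mul1r -sqr_normF expr2.
  by rewrite mulfK// gt_eqF.
move=> /cvg_lim; rewrite (lim_near_cst _ HH)// => nH0.
by move: nH; rewrite nH0// ltxx.
Unshelve. all: by end_near. Qed.

End Gradient.

(** * First-order expansion of the H2 norm *)

Section Expansion.
Context {R : realType}.

Lemma norm_trmx m n (X : 'M[R]_(m, n)) : `|X^T| = `|X|.
Proof.
have le (q s : nat) (Y : 'M[R]_(q, s)) : `|Y^T| <= `|Y|.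
  by apply: norm_le_entry => // i j; rewrite mxE le_entry_norm.
apply/le_anti/andP; split; first exact: le.
by have := le _ _ X^T; rewrite trmxK.
Qed.

(** The transpose solves the same equation. *)
Lemma gramian_sym n (A V P : 'M[R]_n) :
  expmx_vanishes A -> V^T = V -> sylvester A A P + V = 0 -> P^T = P.
Proof.
move=> A0 Vsym PV; apply/eqP; rewrite -subr_eq0; apply/eqP.
apply: (sylvester_inj A0 A0); rewrite linearB/=.
have -> : sylvester A A P^T = (sylvester A A P)^T.
  by rewrite /sylvester raddfD/= !trmx_mul trmxK addrC.
move/eqP: PV; rewrite addr_eq0 => /eqP ->.
by rewrite linearN/= Vsym subrr.
Qed.

Variables (n m p : nat) (A : 'M[R]_n) (B : 'M[R]_(n, m)) (C : 'M[R]_(p, n)).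
Variables (M : 'I_p -> 'M[R]_n) (P L : 'M[R]_n).
Hypotheses (Msym : forall k, (M k)^T = M k) (Psym : P^T = P) (Lsym : L^T = L).
Hypothesis A0 : expmx_vanishes A.
Hypothesis AP : sylvester A A P + B *m B^T = 0.
Hypothesis AL : sylvester A^T A^T L + (C^T *m C + 2 *: \sum_k M k *m P *m M k) = 0.

(** Symmetry of the [M_k] makes this operator self-adjoint for the trace form,
so that the derivative of the quadratic form [tr (Mop P P)] is
[2 tr (Mop P X)]. *)
Let Mop X : 'M[R]_n := \sum_k M k *m X *m M k.

Let MopD X Y : Mop (X + Y) = Mop X + Mop Y.
Proof. by rewrite -big_split; apply: eq_bigr => k _; rewrite mulmxDr mulmxDl. Qed.

Let MopC X Y : \tr (Mop X *m Y) = \tr (Mop Y *m X).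
Proof.
rewrite /Mop !mulmx_suml !raddf_sum/=; apply: eq_bigr => k _.
by rewrite -mulmxA mxtrace_mulC mulmxA.
Qed.

Let Mop_trmx X : (Mop X)^T = Mop X^T.
Proof.
rewrite /Mop raddf_sum/=; apply: eq_bigr => k _.
by rewrite !trmx_mul Msym mulmxA.
Qed.

Let norm_Mop X :
  `|Mop X| <= (\sum_k n%:R * (n%:R * (`|M k| * `|M k|))) * `|X|.
Proof.
rewrite mulr_suml; apply: le_trans (ler_norm_sum _ _ _) _.
apply: ler_sum => k _; apply: le_trans (norm_mulmx_le _ _) _.
rewrite -!mulrA ler_wpM2l//.
apply: le_trans (_ : n%:R * (`|M k| * `|X|) * `|M k| <= _).
  by rewrite ler_wpM2r// norm_mulmx_le.
by rewrite -!mulrA [`|X| * _]mulrC.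
Qed.

Let costE A' (B' : 'M[R]_(n, m)) X :
  gramian_cost (LQO A' B' C M) X = \tr (C^T *m C *m X) + \tr (Mop X *m X).
Proof.
rewrite /gramian_cost/=; congr (_ + \tr (_ *m _)).
by apply: eq_bigr => k _; rewrite Msym.
Qed.

(** The change of the cost is expressed through the data [V] of the Lyapunov
equation, not through its solution.  [A'] and [B'] are arbitrary because the
cost sees them only through [P']; a perturbation of [A] is thus recast as one
of [V] with the operator of [A] kept. *)
Lemma gramian_cost_perturbation :
  exists2 K : R, 0 <= K & forall (V P' : 'M[R]_n) A' (B' : 'M[R]_(n, m)),
    sylvester A A P' + V = 0 ->
    `|P' - P| <= K * `|V - B *m B^T| /\
    `|gramian_cost (LQO A' B' C M) P' - gramian_cost (LQO A B C M) P
        - dotF L (V - B *m B^T)| <= K * `|V - B *m B^T| ^+ 2.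
Proof.
have [_ [K [K0 _ SK]]] := @sylvester_bounded_inverse R n n A A A0 A0.
pose c := (n * n)%:R * \sum_(k < p) (n%:R * (n%:R * (`|M k| * `|M k|))).
have c0 : 0 <= c by rewrite mulr_ge0// sumr_ge0// => k _; rewrite !mulr_ge0.
have Mc X : `|\tr (Mop X *m X)| <= c * `|X| ^+ 2.
  rewrite -[Mop X]trmxK -/(dotF _ _); apply: le_trans (norm_dotF_le _ _) _.
  rewrite -mulrA ler_wpM2l// expr2 mulrA ler_wpM2r// norm_trmx.
  exact: norm_Mop.
exists (K + c * K ^+ 2) => [|V P' A' B' PV]; first by rewrite addr_ge0// mulr_ge0// sqr_ge0.
set E := V - B *m B^T.
have [X XP] : exists X, P' - P = X by exists (P' - P).
have P'E : P' = P + X by rewrite -XP addrC subrK.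
have SX : sylvester A A X = - E.
  move/eqP: PV; rewrite addr_eq0 => /eqP PV; move/eqP: AP; rewrite addr_eq0 => /eqP PB.
  by rewrite -XP linearB/= PV PB opprK opprB addrC.
have XE : `|X| <= K * `|E| by have := SK X; rewrite SX normrN.
split.
  by rewrite XP; apply: le_trans XE _; rewrite ler_wpM2r// lerDl mulr_ge0// sqr_ge0.
have -> : gramian_cost (LQO A' B' C M) P' - gramian_cost (LQO A B C M) P - dotF L E =
    \tr (Mop X *m X).
  have -> : dotF L E = dotF (C^T *m C + 2 *: Mop P) X.
    move/eqP: AL; rewrite addrC addr_eq0 => /eqP ->.
    by rewrite dotFNl dotF_sylvester SX dotFNr opprK.
  rewrite dotFDl dotFZl /dotF trmx_mul trmxK Mop_trmx Psym.
  rewrite !costE P'E MopD !(mulmxDl, mulmxDr) !mxtraceD [\tr (Mop X *m P)]MopC.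
  by ring.
apply: le_trans (Mc X) _.
apply: le_trans (_ : c * K ^+ 2 * `|E| ^+ 2 <= _).
  by rewrite -mulrA -exprMn ler_wpM2l// lerXn2r ?nnegrE ?mulr_ge0.
by rewrite ler_wpM2r ?sqr_ge0// lerDr.
Qed.

Lemma dotF_symmetrized q (D U : 'M[R]_(n, q)) :
  dotF L (D *m U^T + U *m D^T) = 2 * dotF (L *m U) D.
Proof.
have H : dotF L (D *m U^T) = dotF (L *m U) D.
  by rewrite /dotF trmx_mul mulmxA mxtrace_mulC mulmxA.
have H' : dotF L (U *m D^T) = dotF L (D *m U^T).
  by rewrite /dotF -[LHS]mxtrace_tr !trmx_mul !trmxK [RHS]mxtrace_mulC Lsym.
by rewrite dotFDr H' H; ring.
Qed.

(** Here [V = B B^T + D P' + P' D^T] involves the perturbed solution [P'].  The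
bound [|P' - P| <= K |V - B B^T|] gives first [|P'| <= 2 |P|] for small [D] and
then [P' - P = O(D)], which allows [P] to replace [P'] in the linear term. *)
Lemma gramian_cost_expansion_A :
  exists K : R, \forall D \near (0 : 'M[R]_n), forall P' : 'M[R]_n,
    P'^T = P' -> sylvester (A + D) (A + D) P' + B *m B^T = 0 ->
    `|gramian_cost (LQO (A + D) B C M) P' - gramian_cost (LQO A B C M) P
      - dotF (2 *: (L *m P)) D| <= K * `|D| ^+ 2.
Proof.
have [K K0 PK] := gramian_cost_perturbation.
pose e := 4 * n%:R * `|P|.
have e0 : 0 <= e by rewrite !mulr_ge0.
exists (K * e ^+ 2 + 2 * ((n * n)%:R * (n%:R * (`|L| * (K * e))))).
(* For such [D], [K |V - B B^T| <= |P'| / 2]. *)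
have d0 : 0 < (4 * n%:R * K + 1)^-1 by rewrite invr_gt0 ltr_wpDl// !mulr_ge0.
have Dlt := @pseudometric_normed_Zmodule.nbhs0_lt _ 'M[R]_n _ d0.
near=> D; move=> P' P'sym P'D.
have D0 := normr_ge0 D.
have Dsmall : 4 * n%:R * K * `|D| <= 1.
  have : `|D| < (4 * n%:R * K + 1)^-1 by near: D; exact: Dlt.
  rewrite -[_^-1]mul1r ltr_pdivlMr ?ltr_wpDl ?mulr_ge0//.
  by rewrite mulrDr mulr1 mulrC; lra.
pose V := B *m B^T + (D *m P'^T + P' *m D^T).
have PV : sylvester A A P' + V = 0.
  rewrite -[RHS]P'D /sylvester /V P'sym raddfD/= mulmxDl mulmxDr.
  by rewrite [A *m P' + D *m P' + _]addrACA [in LHS]addrCA addrC.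
have VB : V - B *m B^T = D *m P'^T + P' *m D^T by rewrite /V addrC addKr.
have := PK V P' (A + D) B PV; rewrite VB => -[].
set E := D *m P'^T + _ => XE costE'.
have EP' : `|E| <= 2 * n%:R * (`|D| * `|P'|).
  apply: le_trans (ler_normD _ _) _.
  have := norm_mulmx_le D P'^T; have := norm_mulmx_le P' D^T.
  by rewrite !norm_trmx [`|P'| * _]mulrC; lra.
have P'P : `|P'| <= 2 * `|P|.
  have : `|P'| <= `|P| + `|P' - P| by rewrite -[X in `|X| <= _](subrKC P) ler_normD.
  have : K * `|E| <= `|P'| / 2.
    apply: le_trans (_ : K * (2 * n%:R * (`|D| * `|P'|)) <= _); first by rewrite ler_wpM2l.
    have := ler_wpM2r (normr_ge0 P') Dsmall; lra.
  lra.
have Ee : `|E| <= e * `|D|.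
  apply: le_trans EP' _; rewrite /e.
  have : n%:R * `|D| * `|P'| <= n%:R * `|D| * (2 * `|P|) by rewrite ler_wpM2l ?mulr_ge0.
  lra.
have -> : gramian_cost (LQO (A + D) B C M) P' - gramian_cost (LQO A B C M) P
    - dotF (2 *: (L *m P)) D =
    (gramian_cost (LQO (A + D) B C M) P' - gramian_cost (LQO A B C M) P - dotF L E)
    + 2 * dotF (L *m (P' - P)) D.
  by rewrite dotF_symmetrized dotFZl mulmxBr dotFDl dotFNl; ring.
apply: le_trans (ler_normD _ _) _; rewrite [leRHS]mulrDl; apply: lerD.
  apply: le_trans costE' _; rewrite -mulrA -exprMn ler_wpM2l//.
  by rewrite lerXn2r ?nnegrE ?mulr_ge0.
rewrite normrM ger0_norm// -[leRHS]mulrA ler_wpM2l//.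
apply: le_trans (norm_dotF_le _ _) _; rewrite -[leRHS]mulrA ler_wpM2l//.
rewrite expr2 [leRHS]mulrA ler_wpM2r//.
apply: le_trans (norm_mulmx_le _ _) _; rewrite -[leRHS]mulrA ler_wpM2l//.
rewrite -[leRHS]mulrA ler_wpM2l// -mulrA; apply: le_trans XE _.
by rewrite ler_wpM2l.
Unshelve. all: by end_near. Qed.

Lemma gramian_cost_expansion_B :
  exists K : R, \forall D \near (0 : 'M[R]_(n, m)), forall P' : 'M[R]_n,
    sylvester A A P' + (B + D) *m (B + D)^T = 0 ->
    `|gramian_cost (LQO A (B + D) C M) P' - gramian_cost (LQO A B C M) P
      - dotF (2 *: (L *m B)) D| <= K * `|D| ^+ 2.
Proof.
have [K K0 PK] := gramian_cost_perturbation.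
pose e := m%:R * (2 * `|B| + 1).
have e0 : 0 <= e by rewrite !mulr_ge0// addr_ge0// mulr_ge0.
exists (K * e ^+ 2 + (n * n)%:R * (`|L| * m%:R)).
have Dlt := @pseudometric_normed_Zmodule.nbhs0_lt _ 'M[R]_(n, m) _ (@ltr01 R).
near=> D; move=> P' P'D.
have D0 := normr_ge0 D.
have D1 : `|D| < 1 by near: D; exact: Dlt.
have [_] := PK _ P' A (B + D) P'D.
have -> : (B + D) *m (B + D)^T - B *m B^T = D *m B^T + B *m D^T + D *m D^T.
  rewrite raddfD/= mulmxDl !mulmxDr; apply/matrixP => i j; rewrite !mxE; ring.
set E := _ + D *m D^T => costE'.
have DD : `|D *m D^T| <= m%:R * (`|D| * `|D|).
  by have := norm_mulmx_le D D^T; rewrite norm_trmx.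
have Ee : `|E| <= e * `|D|.
  apply: le_trans (ler_normD _ _) _; apply: le_trans (lerD (ler_normD _ _) DD) _.
  have := norm_mulmx_le D B^T; have := norm_mulmx_le B D^T; rewrite !norm_trmx.
  have : m%:R * (`|D| * `|D|) <= m%:R * `|D|.
    by rewrite ler_wpM2l// ler_piMr// ltW.
  rewrite /e; lra.
have -> : gramian_cost (LQO A (B + D) C M) P' - gramian_cost (LQO A B C M) P
    - dotF (2 *: (L *m B)) D =
    (gramian_cost (LQO A (B + D) C M) P' - gramian_cost (LQO A B C M) P - dotF L E)
    + dotF L (D *m D^T).
  by rewrite dotFDr dotF_symmetrized dotFZl; ring.
apply: le_trans (ler_normD _ _) _; rewrite [leRHS]mulrDl; apply: lerD.
  apply: le_trans costE' _; rewrite -mulrA -exprMn ler_wpM2l//.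
  by rewrite lerXn2r ?nnegrE ?mulr_ge0.
apply: le_trans (norm_dotF_le _ _) _; rewrite -[leRHS]mulrA ler_wpM2l//.
by rewrite -mulrA ler_wpM2l// expr2.
Unshelve. all: by end_near. Qed.

Let norm_dotF_sandwich q (U : 'M[R]_q) (D : 'M[R]_(q, n)) :
  `|dotF D (U *m D *m P)| <=
  (q * n)%:R * (n%:R * (q%:R * `|U|) * `|P|) * `|D| ^+ 2.
Proof.
apply: le_trans (norm_dotF_le _ _) _; rewrite -mulrA ler_wpM2l//.
rewrite mulrC expr2 [leRHS]mulrA ler_wpM2r//.
apply: le_trans (norm_mulmx_le _ _) _.
rewrite -!mulrA ler_wpM2l// [`|P| * _]mulrC !mulrA ler_wpM2r// -mulrA.
exact: norm_mulmx_le.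
Qed.

Lemma gramian_cost_expansion_C :
  exists K : R, forall D : 'M[R]_(p, n),
    `|gramian_cost (LQO A B (C + D) M) P - gramian_cost (LQO A B C M) P
      - dotF (2 *: (C *m P)) D| <= K * `|D| ^+ 2.
Proof.
eexists=> D; rewrite [X in `|X|](_ : _ = dotF D (1%:M *m D *m P)).
  exact: norm_dotF_sandwich.
have CD : \tr (C^T *m D *m P) = dotF (C *m P) D.
  by rewrite /dotF trmx_mul Psym mxtrace_mulC mulmxA.
have DC : \tr (D^T *m C *m P) = dotF (C *m P) D.
  by rewrite dotFC /dotF mulmxA.
have trD : (C + D)^T = C^T + D^T by rewrite raddfD.
rewrite /gramian_cost/= trD !(mulmxDl, mulmxDr) !mxtraceD dotFZl CD DC.
by rewrite mul1mx [dotF D _]/dotF mulmxA; ring.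
Qed.

Lemma gramian_cost_expansion_M (k : 'I_p) :
  exists K : R, forall (M' : 'I_p -> 'M[R]_n) (D : 'M[R]_n),
    M' k = M k + D -> (forall j, j != k -> M' j = M j) ->
    `|gramian_cost (LQO A B C M') P - gramian_cost (LQO A B C M) P
      - dotF (2 *: (P *m M k *m P)) D| <= K * `|D| ^+ 2.
Proof.
eexists=> M' D M'k M'j; rewrite [X in `|X|](_ : _ = dotF D (P *m D *m P)).
  exact: norm_dotF_sandwich.
have MD : \tr ((M k)^T *m P *m D *m P) = dotF (P *m M k *m P) D.
  by rewrite /dotF !trmx_mul Psym [LHS]mxtrace_mulC !mulmxA.
have DM : \tr (D^T *m P *m M k *m P) = dotF (P *m M k *m P) D.
  by rewrite dotFC /dotF !mulmxA.
have trD : (M k + D)^T = (M k)^T + D^T by rewrite raddfD.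
rewrite /gramian_cost/= (bigD1 k)//= [\sum_(j < p) (M j)^T *m _ *m _](bigD1 k)//=.
rewrite (eq_bigr (fun j => (M j)^T *m P *m M j)); last by move=> j jk; rewrite M'j.
rewrite M'k trD !(mulmxDl, mulmxDr) !mxtraceD dotFZl MD DM.
by rewrite [dotF D _]/dotF !mulmxA; ring.
Qed.

End Expansion.

(** * Gradients with respect to the reduced system *)

Section Blocks.
Context {R : realType}.

Lemma sum_block_mx (I : Type) (s : seq I) m1 m2 n1 n2 (a : I -> 'M[R]_(m1, n1))
    (b : I -> 'M[R]_(m1, n2)) (c : I -> 'M[R]_(m2, n1)) (d : I -> 'M[R]_(m2, n2)) :
  \sum_(i <- s) block_mx (a i) (b i) (c i) (d i) =
  block_mx (\sum_(i <- s) a i) (\sum_(i <- s) b i)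
           (\sum_(i <- s) c i) (\sum_(i <- s) d i).
Proof.
elim: s => [|i s IH]; first by rewrite !big_nil block_mx0.
by rewrite !big_cons IH add_block_mx.
Qed.

Lemma norm_block_dr_le m1 m2 n1 n2 (d : 'M[R]_(m2, n2)) :
  `|block_mx (0 : 'M[R]_(m1, n1)) 0 0 d| <= `|d|.
Proof.
apply: norm_le_entry => // i j.
case: (split_ordP i) => {}i ->; case: (split_ordP j) => {}j ->.
- by rewrite block_mxEul mxE normr0.
- by rewrite block_mxEur mxE normr0.
- by rewrite block_mxEdl mxE normr0.
- by rewrite block_mxEdr le_entry_norm.
Qed.

Lemma norm_col_d_le m1 m2 n (d : 'M[R]_(m2, n)) :
  `|col_mx (0 : 'M[R]_(m1, n)) d| <= `|d|.
Proof.
apply: norm_le_entry => // i j; case: (split_ordP i) => {}i ->.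
  by rewrite col_mxEu mxE normr0.
by rewrite col_mxEd le_entry_norm.
Qed.

Lemma norm_row_r_le m n1 n2 (d : 'M[R]_(m, n2)) :
  `|row_mx (0 : 'M[R]_(m, n1)) d| <= `|d|.
Proof.
apply: norm_le_entry => // i j; case: (split_ordP j) => {}j ->.
  by rewrite row_mxEl mxE normr0.
by rewrite row_mxEr le_entry_norm.
Qed.

(** Transfers an expansion in the matrices of the error system to one in a
matrix of the reduced system, embedded as a block. *)
Lemma near0_contraction m n m' n' (g : 'M[R]_(m, n) -> 'M[R]_(m', n'))
    (Q : 'M[R]_(m', n') -> Prop) :
  (forall d, `|g d| <= `|d|) ->
  (\forall D \near (0 : 'M[R]_(m', n')), Q D) ->
  \forall d \near (0 : 'M[R]_(m, n)), Q (g d).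
Proof.
move=> gle /nbhs_norm0P[e /= e0 Qe]; apply/nbhs_norm0P; exists e => //= d /= de.
by apply: Qe => /=; apply: le_lt_trans (gle d) de.
Qed.

Lemma dotF_block_dr m1 m2 n1 n2 (a : 'M[R]_(m1, n1)) (b : 'M[R]_(m1, n2))
    (c : 'M[R]_(m2, n1)) (e d : 'M[R]_(m2, n2)) :
  dotF (block_mx a b c e) (block_mx 0 0 0 d) = dotF e d.
Proof.
rewrite /dotF tr_block_mx mulmx_block !mulmx0 !add0r mxtrace_block.
by rewrite raddf0 add0r.
Qed.

Lemma dotF_col_d m1 m2 n (a : 'M[R]_(m1, n)) (b d : 'M[R]_(m2, n)) :
  dotF (col_mx a b) (col_mx 0 d) = dotF b d.
Proof. by rewrite /dotF tr_col_mx mul_row_col mulmx0 add0r. Qed.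

Lemma dotF_row_r m n1 n2 (a : 'M[R]_(m, n1)) (b d : 'M[R]_(m, n2)) :
  dotF (row_mx a b) (row_mx 0 d) = dotF b d.
Proof.
by rewrite /dotF tr_row_mx mul_col_row !mulmx0 mxtrace_block raddf0 add0r.
Qed.

Lemma sylvester_trmx_unique n r (A : 'M[R]_n) (D : 'M[R]_r) (V : 'M[R]_(n, r)) :
  expmx_vanishes A -> expmx_vanishes D ->
  exists X, unique (fun Y => A^T *m Y + Y *m D + V = 0) X.
Proof.
move=> /expmx_vanishes_trmx A0 /expmx_vanishes_trmx D0.
by have := sylvester_unique V A0 D0; rewrite /sylvester trmxK.
Qed.

End Blocks.

Section ErrorGramians.
Context {R : realType} {n r m p : nat}.
Variables (A : 'M[R]_n) (B : 'M[R]_(n, m)) (C : 'M[R]_(p, n)) (M : 'I_p -> 'M[R]_n).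
Variables (Ar : 'M[R]_r) (Br : 'M[R]_(r, m)) (Cr : 'M[R]_(p, r)) (Mr : 'I_p -> 'M[R]_r).

Let S := LQO A B C M.
Let Sr := LQO Ar Br Cr Mr.
Let Se := error_system S Sr.

Lemma error_system_gramian (P11 : 'M[R]_n) (X : 'M[R]_(n, r)) (Pr : 'M[R]_r) :
  sylvester A A P11 + B *m B^T = 0 ->
  sylvester A Ar X + B *m Br^T = 0 ->
  sylvester Ar Ar Pr + Br *m Br^T = 0 ->
  sylvester (lqoA Se) (lqoA Se) (block_mx P11 X X^T Pr)
    + lqoB Se *m (lqoB Se)^T = 0.
Proof.
rewrite /sylvester /= => eP11 eX ePr.
rewrite tr_block_mx tr_col_mx mul_col_row !mulmx_block !trmx0.
rewrite !(mulmx0, mul0mx, addr0, add0r) !add_block_mx eP11 eX ePr.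
have -> : Ar *m X^T + X^T *m A^T + Br *m B^T = (A *m X + X *m Ar^T + B *m Br^T)^T.
  by rewrite !raddfD/= !trmx_mul !trmxK [Ar *m _ + _]addrC.
by rewrite eX trmx0 block_mx0.
Qed.

(** The blocks [L12] and [L22] solve the equations obtained by doubling those
of [Z] and [Qr] and subtracting those of [Z1] and [Q1r]: the weight
[C^T C + 2 sum_k M_k P M_k] counts the quadratic outputs twice and the linear
one once. *)
Lemma error_system_dual_gramian (L11 P11 : 'M[R]_n) (X L12 : 'M[R]_(n, r))
    (Pr L22 : 'M[R]_r) :
  (forall k, (M k)^T = M k) -> (forall k, (Mr k)^T = Mr k) ->
  A^T *m L11 + L11 *m A + (C^T *m C + 2 *: \sum_k M k *m P11 *m M k) = 0 ->
  A^T *m L12 + L12 *m Ar - (C^T *m Cr + 2 *: \sum_k M k *m X *m Mr k) = 0 ->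
  Ar^T *m L22 + L22 *m Ar + (Cr^T *m Cr + 2 *: \sum_k Mr k *m Pr *m Mr k) = 0 ->
  sylvester (lqoA Se)^T (lqoA Se)^T (block_mx L11 L12 L12^T L22) +
   ((lqoC Se)^T *m lqoC Se +
    2 *: \sum_k lqoM Se k *m block_mx P11 X X^T Pr *m lqoM Se k) = 0.
Proof.
move=> symM symMr e11 e12 e22; rewrite /sylvester trmxK /=.
have -> : \sum_k block_mx (M k) 0 0 (- Mr k) *m block_mx P11 X X^T Pr *m
    block_mx (M k) 0 0 (- Mr k) =
    block_mx (\sum_k M k *m P11 *m M k) (- \sum_k M k *m X *m Mr k)
      (- (\sum_k M k *m X *m Mr k)^T) (\sum_k Mr k *m Pr *m Mr k).
  have -> : (\sum_k M k *m X *m Mr k)^T = \sum_k (M k *m X *m Mr k)^T.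
    by rewrite raddf_sum.
  rewrite -!sumrN -sum_block_mx; apply: eq_bigr => k _.
  rewrite !mulmx_block !(mulmx0, mul0mx, addr0, add0r) !(mulmxN, mulNmx) opprK.
  by rewrite !trmx_mul symM symMr mulmxA.
rewrite tr_block_mx tr_row_mx mul_col_row !mulmx_block !trmx0.
rewrite !(mulmx0, mul0mx, addr0, add0r) scale_block_mx !add_block_mx.
have -> : (- Cr)^T = - Cr^T by rewrite raddfN.
rewrite !(mulmxN, mulNmx) opprK !scalerN -!opprD e11 e22 e12.
have -> : Ar^T *m L12^T + L12^T *m A -
    (Cr^T *m C + 2 *: (\sum_k M k *m X *m Mr k)^T) =
    (A^T *m L12 + L12 *m Ar - (C^T *m Cr + 2 *: \sum_k M k *m X *m Mr k))^T.
  rewrite [RHS]linearB/= [(A^T *m _ + _)^T]linearD/= [(C^T *m Cr + _)^T]linearD/=.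
  rewrite [(2 *: _)^T]linearZ/= [(A^T *m _)^T]trmx_mul [(L12 *m _)^T]trmx_mul.
  by rewrite [(C^T *m _)^T]trmx_mul !trmxK [Ar^T *m _ + _]addrC.
by rewrite e12 trmx0 block_mx0.
Qed.

End ErrorGramians.

Theorem theorem3p1 (R : realType) (n r m p : nat)
    (A : 'M[R]_n) (B : 'M[R]_(n, m)) (C : 'M[R]_(p, n)) (M : 'I_p -> 'M[R]_n)
    (Ar : 'M[R]_r) (Br : 'M[R]_(r, m)) (Cr : 'M[R]_(p, r))
    (Mr : 'I_p -> 'M[R]_r)
    (symM : forall k, (M k)^T = M k) (symMr : forall k, (Mr k)^T = Mr k)
    (stabA : asymp_stable A) (stabAr : asymp_stable Ar) :
  let J Ar' Br' Cr' Mr' := H2err2 (LQO A B C M) (LQO Ar' Br' Cr' Mr') in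
  exists (X Z Z1 : 'M[R]_(n, r)) (Pr Qr Q1r : 'M[R]_r),
    [/\ unique (fun P : 'M[R]_r =>
          Ar *m P + P *m Ar^T + Br *m Br^T = 0) Pr,
        unique (fun Q : 'M[R]_r =>
          Ar^T *m Q + Q *m Ar + \sum_(k < p) Mr k *m Pr *m Mr k
            + Cr^T *m Cr = 0) Qr &
        unique (fun Y : 'M[R]_(n, r) =>
          A *m Y + Y *m Ar^T + B *m Br^T = 0) X] /\
    [/\ unique (fun Y : 'M[R]_(n, r) =>
          A^T *m Y + Y *m Ar - \sum_(k < p) M k *m X *m Mr k
            - C^T *m Cr = 0) Z,
        unique (fun Q : 'M[R]_r =>
          Ar^T *m Q + Q *m Ar + Cr^T *m Cr = 0) Q1r &
        unique (fun Y : 'M[R]_(n, r) =>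
          A^T *m Y + Y *m Ar - C^T *m Cr = 0) Z1] /\
    [/\ is_gradient (fun Y => J Y Br Cr Mr) Ar
          (2 *: ((2 *: Qr - Q1r) *m Pr + (2 *: Z^T - Z1^T) *m X)),
        is_gradient (fun Y => J Ar Y Cr Mr) Br
          (2 *: ((2 *: Qr - Q1r) *m Br + (2 *: Z^T - Z1^T) *m B)),
        is_gradient (fun Y => J Ar Br Y Mr) Cr
          (2 *: (Cr *m Pr - C *m X)) &
        forall k : 'I_p,
          is_gradient (fun Y => J Ar Br Cr [eta Mr with k |-> Y]) (Mr k)
            (2 *: (Pr *m Mr k *m Pr - X^T *m M k *m X))].
Proof.
move=> J.
have cA := lyapunov_certified_of_asymp_stable stabA.
have cAr := lyapunov_certified_of_asymp_stable stabAr.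
have vA := expmx_cvg0 cA; have vAr := expmx_cvg0 cAr.
have [X [eX uX]] := sylvester_unique (B *m Br^T) vA vAr.
have [Pr [ePr uPr]] := sylvester_unique (Br *m Br^T) vAr vAr.
have [Qr [eQr uQr]] := sylvester_trmx_unique
  (\sum_(k < p) Mr k *m Pr *m Mr k + Cr^T *m Cr) vAr vAr.
have [Z [eZ uZ]] := sylvester_trmx_unique
  (- (\sum_(k < p) M k *m X *m Mr k) - C^T *m Cr) vA vAr.
have [Q1r [eQ1r uQ1r]] := sylvester_trmx_unique (Cr^T *m Cr) vAr vAr.
have [Z1 [eZ1 uZ1]] := sylvester_trmx_unique (- (C^T *m Cr)) vA vAr.
exists X, Z, Z1, Pr, Qr, Q1r; split; first split.
- by split; [exact: ePr | exact: uPr].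
- split; first by rewrite -addrA.
  by move=> Q; rewrite -addrA; exact: uQr.
- by split; [exact: eX | exact: uX].
split; first split.
- split; first by rewrite -addrA.
  by move=> Y; rewrite -addrA; exact: uZ.
- by split.
- by split.
(* The Gramians [Pe] and [Le] of the error system are assembled from [X], [Pr]
   and combinations of [Z], [Z1], [Qr], [Q1r]; the blocks [P11] and [L11] that
   complete them are determined by the full system alone. *)
have [P11 [eP11 _]] := sylvester_unique (B *m B^T) vA vA.
have [L11 [eL11 _]] := sylvester_trmx_unique
  (C^T *m C + 2 *: \sum_k M k *m P11 *m M k) vA vA.
have vAe : expmx_vanishes (block_mx A 0 0 Ar : 'M[R]_(n + r)).
  exact: expmx_cvg0 (lyapunov_certified_block_diag cA cAr).
pose Be := col_mx B Br; pose Ce := row_mx C (- Cr).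
pose Me k : 'M[R]_(n + r) := block_mx (M k) 0 0 (- Mr k).
pose Pe := block_mx P11 X X^T Pr.
have ePe : sylvester (block_mx A 0 0 Ar) (block_mx A 0 0 Ar) Pe + Be *m Be^T = 0.
  exact: (error_system_gramian C M Cr Mr eP11 eX ePr).
pose L12 := 2 *: Z - Z1; pose L22 := 2 *: Qr - Q1r.
have eL12 : A^T *m L12 + L12 *m Ar - (C^T *m Cr + 2 *: \sum_k M k *m X *m Mr k) = 0.
  move: eZ eZ1; rewrite /L12; move: (\sum_(k < p) _) (C^T *m Cr) => U V eZ eZ1.
  transitivity (2 *: (A^T *m Z + Z *m Ar + (- U - V)) - (A^T *m Z1 + Z1 *m Ar + - V)).
    rewrite !(mulmxBr, mulmxBl) -!(scalemxAl, scalemxAr).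
    by apply/matrixP => i j; rewrite !mxE; ring.
  by rewrite eZ eZ1 scaler0 subrr.
have eL22 : Ar^T *m L22 + L22 *m Ar + (Cr^T *m Cr + 2 *: \sum_k Mr k *m Pr *m Mr k) = 0.
  move: eQr eQ1r; rewrite /L22; move: (\sum_(k < p) _) (Cr^T *m Cr) => U V eQr eQ1r.
  transitivity (2 *: (Ar^T *m Qr + Qr *m Ar + (U + V)) - (Ar^T *m Q1r + Q1r *m Ar + V)).
    rewrite !(mulmxBr, mulmxBl) -!(scalemxAl, scalemxAr).
    by apply/matrixP => i j; rewrite !mxE; ring.
  by rewrite eQr eQ1r scaler0 subrr.
pose Le := block_mx L11 L12 L12^T L22.
have eLe : sylvester (block_mx A 0 0 Ar)^T (block_mx A 0 0 Ar)^T Le +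
    (Ce^T *m Ce + 2 *: \sum_k Me k *m Pe *m Me k) = 0.
  exact: (error_system_dual_gramian B Br symM symMr eL11 eL12 eL22).
have symMe k : (Me k)^T = Me k.
  have NMr : (- Mr k)^T = - Mr k by rewrite raddfN/= symMr.
  by rewrite /Me tr_block_mx !trmx0 symM NMr.
have symPe : Pe^T = Pe.
  by apply: gramian_sym vAe _ ePe; rewrite trmx_mul trmxK.
have symLe : Le^T = Le.
  apply: gramian_sym (expmx_vanishes_trmx vAe) _ eLe.
  rewrite [LHS]raddfD/= trmx_mul trmxK linearZ/= raddf_sum/=; congr (_ + _ *: _).
  by apply: eq_bigr => k _; rewrite !trmx_mul symMe symPe mulmxA.
have JE Ar' Br' Cr' (Mr' : 'I_p -> 'M[R]_r) P' :
    expmx_vanishes (block_mx A 0 0 Ar' : 'M[R]_(n + r)) ->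
    sylvester (block_mx A 0 0 Ar') (block_mx A 0 0 Ar') P' +
      col_mx B Br' *m (col_mx B Br')^T = 0 ->
    J Ar' Br' Cr' Mr' = gramian_cost (LQO (block_mx A 0 0 Ar') (col_mx B Br')
      (row_mx C (- Cr')) (fun k => block_mx (M k) 0 0 (- Mr' k))) P'.
  move=> vA' eP'; exact: (@H2err2_gramian _ _ _ _ _ (LQO A B C M)
    (LQO Ar' Br' Cr' Mr') P' vA' eP').
have L12T : L12^T = 2 *: Z^T - Z1^T by rewrite /L12 raddfB/= linearZ.
(* The absolute value is taken because the constants [K] of the expansions have
   no prescribed sign. *)
have quad_mono (K x y : R) : 0 <= x -> x <= y -> K * x ^+ 2 <= `|K| * y ^+ 2.
  move=> x0 xy; apply: le_trans (_ : `|K| * x ^+ 2 <= _).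
    by rewrite ler_wpM2r ?sqr_ge0// ler_norm.
  by rewrite ler_wpM2l// lerXn2r ?nnegrE// (le_trans x0).
split.
(* Each reduced variable is embedded as the last block of the matching matrix of
   the error system, with the opposite sign for [Cr] and [Mr]. *)
- have [K KD] := gramian_cost_expansion_A symMe symPe symLe vAe ePe eLe.
  apply: is_gradient_quadratic; exists `|K|.
  have KD' := near0_contraction (@norm_block_dr_le R n r n r) KD.
  have cAr' := lyapunov_certified_open cAr.
  near=> d.
  have vd : expmx_vanishes (block_mx A 0 0 (Ar + d) : 'M[R]_(n + r)).
    apply: expmx_cvg0; apply: lyapunov_certified_block_diag => //.
    by near: d; exact: cAr'.
  have [P' [eP' _]] := sylvester_unique (Be *m Be^T) vd vd.
  have symP' : P'^T = P' by apply: gramian_sym vd _ eP'; rewrite trmx_mul trmxK.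
  have AD : block_mx A 0 0 Ar + block_mx 0 0 0 d = block_mx A 0 0 (Ar + d) :> 'M[R]_(n + r).
    by rewrite add_block_mx !addr0.
  rewrite (JE _ _ _ _ _ vd eP') (JE _ _ _ _ _ vAe ePe).
  apply: le_trans (quad_mono K _ _ (normr_ge0 _) (@norm_block_dr_le R n r n r d)).
  have : forall P' : 'M[R]_(n + r), P'^T = P' ->
      sylvester (block_mx A 0 0 Ar + block_mx 0 0 0 d)
        (block_mx A 0 0 Ar + block_mx 0 0 0 d) P' + Be *m Be^T = 0 ->
      `|gramian_cost (LQO (block_mx A 0 0 Ar + block_mx 0 0 0 d) Be Ce Me) P' -
        gramian_cost (LQO (block_mx A 0 0 Ar) Be Ce Me) Pe -
        dotF (2 *: (Le *m Pe)) (block_mx 0 0 0 d)| <=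
      K * `|block_mx (0 : 'M[R]_n) 0 0 d| ^+ 2 by near: d; exact: KD'.
  rewrite AD => /(_ P' symP' eP').
  rewrite /Le /Pe mulmx_block scale_block_mx dotF_block_dr.
  by rewrite L12T [L22 *m _ + _]addrC.
- have [K KD] := gramian_cost_expansion_B symMe symPe symLe vAe ePe eLe.
  apply: is_gradient_quadratic; exists `|K|.
  have KD' := near0_contraction (@norm_col_d_le R n r m) KD.
  near=> d.
  have BD : Be + col_mx 0 d = col_mx B (Br + d) by rewrite add_col_mx addr0.
  have [P' [eP' _]] := sylvester_unique (col_mx B (Br + d) *m (col_mx B (Br + d))^T) vAe vAe.
  rewrite (JE _ _ _ _ _ vAe eP') (JE _ _ _ _ _ vAe ePe).
  apply: le_trans (quad_mono K _ _ (normr_ge0 _) (@norm_col_d_le R n r m d)).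
  have : forall P' : 'M[R]_(n + r),
      sylvester (block_mx A 0 0 Ar) (block_mx A 0 0 Ar) P' +
        (Be + col_mx 0 d) *m (Be + col_mx 0 d)^T = 0 ->
      `|gramian_cost (LQO (block_mx A 0 0 Ar) (Be + col_mx 0 d) Ce Me) P' -
        gramian_cost (LQO (block_mx A 0 0 Ar) Be Ce Me) Pe -
        dotF (2 *: (Le *m Be)) (col_mx 0 d)| <=
      K * `|col_mx (0 : 'M[R]_(n, m)) d| ^+ 2 by near: d; exact: KD'.
  rewrite BD => /(_ P' eP').
  rewrite /Le /Be mul_block_col scale_col_mx dotF_col_d.
  by rewrite L12T [L22 *m _ + _]addrC.
- have [K KD] := gramian_cost_expansion_C (block_mx A 0 0 Ar) Be Ce Me symPe.
  apply: is_gradient_quadratic; exists `|K|; near=> d.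
  have CD : Ce + row_mx 0 (- d) = row_mx C (- (Cr + d)) by rewrite add_row_mx addr0 opprD.
  rewrite !(JE _ _ _ _ _ vAe ePe).
  apply: le_trans (quad_mono K _ _ (normr_ge0 (row_mx (0 : 'M[R]_(p, n)) (- d))) _).
    have := KD (row_mx 0 (- d)); rewrite CD /Ce /Pe mul_row_block scale_row_mx dotF_row_r.
    by rewrite dotFNr -dotFNl -scalerN mulNmx opprB.
  by apply: le_trans (@norm_row_r_le R p n r _) _; rewrite normrN.
move=> k.
have [K KD] := gramian_cost_expansion_M (block_mx A 0 0 Ar) Be Ce Me symPe k.
apply: is_gradient_quadratic; exists `|K|; near=> d.
rewrite !(JE _ _ _ _ _ vAe ePe).
have -> : (fun j => block_mx (M j) 0 0 (- [eta Mr with k |-> Mr k] j)) = Me.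
  by apply/funext => j; rewrite /Me/=; case: eqP => [->|].
apply: le_trans (quad_mono K _ _ (normr_ge0
  (block_mx (0 : 'M[R]_n) (0 : 'M[R]_(n, r)) (0 : 'M[R]_(r, n)) (- d))) _); last first.
  by apply: le_trans (@norm_block_dr_le R n r n r _) _; rewrite normrN.
have := KD (fun j => block_mx (M j) 0 0 (- [eta Mr with k |-> Mr k + d] j))
  (block_mx 0 0 0 (- d)).
rewrite /Me /Pe !mulmx_block scale_block_mx dotF_block_dr dotFNr -dotFNl -scalerN.
rewrite !(mulmx0, mul0mx, addr0, add0r) !(mulmxN, mulNmx) opprB; apply.
- by rewrite /= eqxx add_block_mx !addr0 opprD.
- by move=> j /negbTE jk; rewrite /= jk.
Unshelve. all: by end_near. Qed.
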